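(* For every $s>0$: (i) for every integer $j\ge1$, $q_j(\infty,s)=p_j(\infty,s)$ holds if and only if $q_{j-1}(s)=q_j(s)$; (ii) for every integer $j\ge0$, $q_j(\infty,s)=p_{j+1}(\infty,s)$ holds if and only if $p_j(s)=p_{j+1}(s)$.
   Context: Let $\Pi$ be a homogeneous Poisson point process of unit intensity in the strip $S=[0,1]\times(-\infty,0]$. An atom $a=(x_a,y_a)$ of $\Pi$ is a record if no other atom of $S$ lies to its north-west (smaller horizontal and larger vertical coordinate); its box area is $(1-x_a)\,|y_a|$, the area of the part of $S$ north-east of $a$. Let $W$ be uniform on $[0,1]$ independent of $\Pi$ and $V$ the vertical line $\{x=W\}$. Define $p_j(\infty,s)$ as the probability that exactly $j$ records of $S$ have box area at most $s$, and $q_j(\infty,s)$ as the probability that exactly $j$ records of $S$ lying to the left of $V$ have box area at most $s$. Further, with $\sigma_1(k,j)$ the unsigned Stirling numbers of the first kind ($\sigma_1(k,j)=0$ for $k<j$, $\sigma_1(0,0)=1$), $p_j(t)=e^{-t}\sum_{k=j}^\infty \frac{t^k}{k!}\frac{\sigma_1(k,j)}{k!}$ and $q_j(t)=\frac1t\int_0^t p_j(u)\,du$. *)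

(* Defs.v *)
From HB Require Import structures.
From mathcomp Require Import all_boot all_order all_algebra.
From mathcomp Require Import all_classical all_reals all_analysis.
Import Order.TTheory GRing.Theory Num.Theory.
Import numFieldNormedType.Exports.

Set Implicit Arguments.
Unset Strict Implicit.
Unset Printing Implicit Defensive.

Local Open Scope classical_set_scope.
Local Open Scope ring_scope.

Fixpoint stirling1 (k j : nat) : nat :=
  match k, j with
  | 0, 0 => 1
  | 0, _.+1 => 0
  | _.+1, 0 => 0
  | k'.+1, j'.+1 => (k' * stirling1 k' j + stirling1 k' j')%N
  end.

(* p_j(t) = e^{-t} sum_{k >= j} t^k/k! * s(k,j)/k!  (terms with k<j vanish) *)
Definition pj {R : realType} (j : nat) (t : R) : R :=
  expR (- t) *
  limn (series (fun k : nat =>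
     t ^+ k / (k`!)%:R * ((stirling1 k j)%:R / (k`!)%:R))).

Definition qj {R : realType} (j : nat) (t : R) : R :=
  t^-1 * (\int[@lebesgue_measure R]_(u in `[0, t]%classic) pj j u).

Section Geometry.
Context {R : realType}.

Definition strip : set (R * R) := [set a | 0 <= a.1 <= 1 /\ a.2 <= 0].

Definition north_west (b a : R * R) : Prop := b.1 < a.1 /\ a.2 < b.2.

Definition is_record (X : set (R * R)) (a : R * R) : Prop :=
  X a /\ ~ (exists b, X b /\ b <> a /\ north_west b a).

(* box area: area of the part of S north-east of a *)
Definition box_area (a : R * R) : R := (1 - a.1) * `|a.2|.

Definition records_le (X : set (R * R)) (s : R) : set (R * R) :=
  [set a | is_record X a /\ box_area a <= s].

Definition records_left_le (X : set (R * R)) (w s : R) : set (R * R) :=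
  [set a | is_record X a /\ a.1 < w /\ box_area a <= s].

Definition area (B : set (R * R)) : \bar R :=
  ((@lebesgue_measure R) \x (@lebesgue_measure R))%E B.

End Geometry.

Local Open Scope card_scope.

Section Process.
Context {R : realType} {d : measure_display} {Om : measurableType d}.

Definition count_event (Pi : Om -> set (R * R)) (B : set (R * R)) (k : nat)
  : set Om := [set w | (Pi w `&` B) #= `I_k].

Definition admissible (B : set (R * R)) : Prop :=
  measurable B /\ B `<=` strip /\ (area B < +oo)%E.

Definition poisson_strip_uniform (P : probability Om R)
  (Pi : Om -> set (R * R)) (W : Om -> R) : Prop :=
  (forall w, Pi w `<=` strip) /\
  (forall w (n : nat), finite_set (Pi w `&` [set a | - (n%:R) <= a.2])) /\
  (forall B k, admissible B -> measurable (count_event Pi B k)) /\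
  (forall B k, admissible B ->
     P (count_event Pi B k) =
     (expR (- fine (area B)) * (fine (area B)) ^+ k / (k`!)%:R)%:E) /\
  (forall n (B : 'I_n -> set (R * R)) (k : 'I_n -> nat),
     (forall i, admissible (B i)) ->
     (forall i j, i != j -> B i `&` B j = set0) ->
     P (\bigcap_(i in [set: 'I_n]) count_event Pi (B i) (k i)) =
     (\prod_(i < n) P (count_event Pi (B i) (k i)))%E) /\
  measurable_fun setT W /\
  (forall A, measurable A ->
     P (W @^-1` A) = (@lebesgue_measure R) (A `&` `[0, 1]%classic)) /\
  (forall n (B : 'I_n -> set (R * R)) (k : 'I_n -> nat) (A : set R),
     (forall i, admissible (B i)) -> measurable A ->
     P (W @^-1` A `&` \bigcap_(i in [set: 'I_n]) count_event Pi (B i) (k i)) =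
     (P (W @^-1` A) * P (\bigcap_(i in [set: 'I_n]) count_event Pi (B i) (k i)))%E).

Definition p_inf (P : probability Om R) (Pi : Om -> set (R * R)) (j : nat) (s : R)
  : \bar R := P [set w | records_le (Pi w) s #= `I_j].

Definition q_inf (P : probability Om R) (Pi : Om -> set (R * R)) (W : Om -> R)
  (j : nat) (s : R) : \bar R :=
  P [set w | records_left_le (Pi w) (W w) s #= `I_j].

End Process.

(* Main.v *)
(* Follow the hyperbola from z_0 = (0, -s) through z_x = (x, -s/(1-x)) as x grows to 1.
   While no atom lies north-west of z_x, the staircase of records has not met the
   hyperbola.  Where they meet, the box north-east of z_x has area s, and the records
   of box area at most s are exactly those of this box.  If they meet on a horizontal
   step, their number follows p_j(s); if they meet on a vertical one, there is one
   record on the left side of the box, at uniform depth, and the remaining ones follow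
   q_{j-1}(s).  With H = \int_0^1 exp(-x s/(1-x)) dx this gives
     p_j(oo,s) = H p_j(s) + (1-H) q_{j-1}(s),
   and, averaging over V, q_j(oo,s) = H p_j(s) + (1-H) q_j(s).  Both equivalences
   follow because 0 < H < 1.

   The laws inside a box come from the same exploration with a vertical line in place
   of the hyperbola; it leads to p_{j+1}' = q_j - p_{j+1} and (t q_j)' = p_j, which the
   given power series satisfy.  In both cases one step of length h is computed up to an
   error O(h^2), and a function whose increments are O(h^2) is constant. *)
Require Import Defs.
From HB Require Import structures.
From mathcomp Require Import all_boot all_order all_algebra.
From mathcomp Require Import all_classical all_reals all_analysis.
From mathcomp Require Import measurable_realfun ring lra.
Import Order.TTheory GRing.Theory Num.Theory.
Import numFieldNormedType.Exports.
Local Open Scope classical_set_scope.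
Local Open Scope ring_scope.
Set Implicit Arguments.
Unset Strict Implicit.
Unset Printing Implicit Defensive.

(** * The power series p_j and q_j *)

Section PowerSeries.
Variable R : realType.
Implicit Types (c : R ^nat) (t : R) (j k : nat).

(** The point where staircase and hyperbola meet is never constructed as a random variable. What is
    followed, as a function of x, is the probability that nothing has been met before x and that j
    records are counted. A step from c to d compares two events that agree outside an exceptional
    event whose probability is of second order. No regularity of these probabilities is known
    beforehand, so on their side increments with quadratic errors take the place of differential
    equations; only explicit functions are differentiated.

    Counting all records and counting those left of V is a single argument about a vertical line
    independent of the process: the uniform line, or the line x = 2 beyond the strip.

    H is the probability of meeting on a horizontal step. With e(u) = exp(-u s/(1-u)), the abscissa
    u of the meeting has density -e'(u), the meeting is horizontal with probability u, and
    integrating -u e'(u) by parts gives the integral of e. *)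

Lemma cvg_pseries_entire c t : (forall k, `|c k| <= k`!%:R^-1) ->
  cvgn (pseries c t).
Proof.
move=> hc; apply: normed_cvg.
apply: (series_le_cvg _ _ _ (is_cvg_series_exp_coeff `|t|)) => n /=.
- by rewrite normr_ge0.
- by rewrite /exp_coeff /= mulr_ge0// ?exprn_ge0// invr_ge0.
- by rewrite /exp_coeff /= normrM normrX mulrC ler_wpM2l// exprn_ge0.
Qed.

(** The bound 1/k! survives termwise differentiation since (k+1)/(k+1)! = 1/k!, so the series at
    hand can be differentiated repeatedly. *)
Lemma pseries_diffs_entire c : (forall k, `|c k| <= k`!%:R^-1) ->
  forall k, `|pseries_diffs c k| <= k`!%:R^-1.
Proof.
move=> hc k; rewrite /pseries_diffs normrM ger0_norm//.
apply: (le_trans (ler_wpM2l _ (hc k.+1))) => //.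
by rewrite factS natrM invfM mulVKf.
Qed.

Lemma is_derive_pseries_entire c t : (forall k, `|c k| <= k`!%:R^-1) ->
  is_derive t (1 : R) (fun x => limn (pseries c x))
    (limn (pseries (pseries_diffs c) t)).
Proof.
move=> hc; have h1 := pseries_diffs_entire hc.
have h2 := pseries_diffs_entire h1.
apply: (@pseries_snd_diffs _ c (`|t| + 1)); try exact: cvg_pseries_entire.
by rewrite [ltRHS]ger0_norm ?addr_ge0// ltrDl.
Qed.

Lemma cvg_pseries_natr c t : (forall k, `|c k| <= k`!%:R^-1) ->
  pseries (fun k => k%:R * c k) t @ \oo -->
  t * limn (pseries (pseries_diffs c) t).
Proof.
move=> hc.
have := @pseries_diffs_equiv _ c t (cvg_pseries_entire (pseries_diffs_entire hc)).
move=> /= h; apply: (cvg_trans _ (cvgMl_tmp (a := t) h)).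
apply: near_eq_cvg; apply: nearW => n /=.
rewrite /pseries /series /= mulr_sumr; apply: eq_bigr => -[|i] _ /=.
  by rewrite !mul0r mulr0.
by rewrite exprS; ring.
Qed.

Lemma stirling1_le_fact k j : (stirling1 k j <= k`!)%N.
Proof.
elim: k j => [|k IH] [|j] //=.
rewrite factS mulSn addnC; apply: leq_add; first exact: IH.
by rewrite leq_mul2l IH orbT.
Qed.

(** [stirling1 k j] / k! is the probability that a uniform permutation of k elements has j
    left-to-right records; the other k! belongs to the Poisson weight. *)
Definition record_coeff j k : R := (stirling1 k j)%:R / k`!%:R / k`!%:R.

Lemma record_coeff_entire j k : `|record_coeff j k| <= k`!%:R^-1.
Proof.
rewrite /record_coeff ger0_norm ?divr_ge0// ler_piMl ?invr_ge0//.
by rewrite ler_pdivrMr ?ltr0n ?fact_gt0// mul1r ler_nat stirling1_le_fact.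
Qed.

Lemma pjE j t : pj j t = expR (- t) * limn (pseries (record_coeff j) t).
Proof.
rewrite /pj (_ : series _ = pseries (record_coeff j) t)//.
apply/funext => n; apply: eq_bigr => i _ /=.
by rewrite /record_coeff; ring.
Qed.

(* [q_j = p_{j+1}' + p_{j+1}], which turns [q_j] into a power series as well. *)
Definition qser j t : R :=
  expR (- t) * limn (pseries (pseries_diffs (record_coeff j.+1)) t).

(** The recurrence s(k+1,j+1) = k s(k,j+1) + s(k,j) divided by k!^2: the first two terms on the
    right add up to s(k+1,j+1)/k!^2. *)
Lemma record_coeffS j k :
  record_coeff j k = pseries_diffs (record_coeff j.+1) k +
    k%:R * pseries_diffs (record_coeff j.+1) k - k%:R * record_coeff j.+1 k.
Proof.
rewrite /record_coeff /pseries_diffs /= natrD natrM factS natrM.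
have k0 : (k`!%:R : R) != 0 by rewrite pnatr_eq0 -lt0n fact_gt0.
have k1 : (k.+1%:R : R) != 0 by rewrite pnatr_eq0.
rewrite -[k.+1]addn1 natrD in k1 *; field.
by rewrite k0 k1.
Qed.

Lemma record_pseriesS j t : limn (pseries (record_coeff j) t) =
  limn (pseries (pseries_diffs (record_coeff j.+1)) t) +
  t * limn (pseries (pseries_diffs (pseries_diffs (record_coeff j.+1))) t) -
  t * limn (pseries (pseries_diffs (record_coeff j.+1)) t).
Proof.
have h0 := record_coeff_entire j.+1.
have h1 := pseries_diffs_entire h0.
apply: cvg_lim => //.
rewrite (_ : pseries (record_coeff j) t =
  pseries (pseries_diffs (record_coeff j.+1)) t +
  pseries (fun k => k%:R * pseries_diffs (record_coeff j.+1) k) t -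
  pseries (fun k => k%:R * record_coeff j.+1 k) t).
  apply: cvgB; last exact: cvg_pseries_natr.
  by apply: cvgD; [exact: cvg_pseries_entire|exact: cvg_pseries_natr].
apply/funext => n.
rewrite /pseries /series /= !fctE -big_split -sumrB /=; apply: eq_bigr => i _.
by rewrite record_coeffS; ring.
Qed.

Lemma is_derive_expRN t : is_derive t (1 : R) (fun x => expR (- x)) (- expR (- t)).
Proof.
have h := @is_derive1_comp R expR -%R t _ _ (is_derive_expR _) (is_deriveNid t 1).
by apply: (@is_derive_eq _ _ _ _ _ _ _ _ h); rewrite /GRing.scale /=; ring.
Qed.

Lemma pj0E t : pj 0 t = expR (- t).
Proof.
rewrite pjE (_ : limn (pseries _ t) = 1) ?mulr1//; apply: cvg_lim => //.
apply: cvg_near_cst; exists 1%N => //= -[|n] _ //.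
rewrite /pseries /series /= big_nat_recl//= big1 => [|i _].
  by rewrite /record_coeff /= expr0 fact0 !divr1 mulr1 addr0.
by rewrite /record_coeff /= !mul0r.
Qed.

Lemma is_derive_pjS j t :
  is_derive t (1 : R) (pj j.+1) (qser j t - pj j.+1 t).
Proof.
rewrite (_ : pj j.+1 = (fun x => expR (- x)) *
    (fun x => limn (pseries (record_coeff j.+1) x))); last first.
  by apply/funext => x; rewrite pjE.
apply: (@is_derive_eq _ _ _ _ _ _ _ _ (is_deriveM (is_derive_expRN t)
  (is_derive_pseries_entire t (record_coeff_entire j.+1)))).
by rewrite /= /qser /GRing.scale /= !fctE; ring.
Qed.

Lemma is_derive_pj0 t : is_derive t (1 : R) (pj 0) (- pj 0 t).
Proof.
rewrite (_ : pj 0 = fun x => expR (- x)); first exact: is_derive_expRN.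
by apply/funext => x; rewrite pj0E.
Qed.

Definition dqser j t : R := expR (- t) *
  limn (pseries (pseries_diffs (pseries_diffs (record_coeff j.+1))) t) - qser j t.

Lemma is_derive_qser j t : is_derive t (1 : R) (qser j) (dqser j t).
Proof.
apply: (@is_derive_eq _ _ _ _ _ _ _ _ (is_deriveM (is_derive_expRN t)
  (is_derive_pseries_entire t (pseries_diffs_entire (record_coeff_entire j.+1))))).
by rewrite /= /dqser /qser /GRing.scale /=; ring.
Qed.

(** The Stirling recurrence in the differential form (t q_j)' = p_j; multiplying by t instead of
    dividing keeps it valid at t = 0. *)
Lemma mul_dqser j t : t * dqser j t = pj j t - qser j t.
Proof. by rewrite pjE record_pseriesS /dqser /qser; ring. Qed.

Lemma is_derive_mul_qser j t : is_derive t (1 : R) (fun x => x * qser j x) (pj j t).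
Proof.
apply: (@is_derive_eq _ _ _ _ _ _ _ _ (is_deriveM (is_derive_id t 1)
  (is_derive_qser j t))).
by rewrite /GRing.scale /= mul_dqser; ring.
Qed.

Lemma continuous_of_is_derive (f g : R -> R) :
  (forall x, is_derive x (1 : R) f (g x)) -> continuous f.
Proof.
by move=> fg x; apply: differentiable_continuous; apply/derivable1_diffP; have [] := fg x.
Qed.

Lemma continuous_pj j : continuous (pj j : R -> R).
Proof.
case: j => [|j]; apply: continuous_of_is_derive.
- exact: is_derive_pj0.
- exact: is_derive_pjS.
Qed.

Lemma continuous_qser j : continuous (qser j).
Proof. exact: continuous_of_is_derive (is_derive_qser j). Qed.

Lemma continuous_dqser j : continuous (dqser j).
Proof.
have h := is_derive_pseries_entire _
  (pseries_diffs_entire (pseries_diffs_entire (record_coeff_entire j.+1))).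
have g t := is_deriveB (is_deriveM (is_derive_expRN t) (h t)) (is_derive_qser j t).
exact: continuous_of_is_derive g.
Qed.

(** [x * qser j x] is the primitive of [pj j] that vanishes at 0. Positivity of t matters: at 0 the
    inverse in [qj] is 0, whereas [qser 0 0] is 1. *)
Lemma qjE j t : 0 < t -> qj j t = qser j t.
Proof.
move=> t0; rewrite /qj /Rintegral.
rewrite (@continuous_FTC2 R (pj j) (fun x : R => x * qser j x)) //=.
- by rewrite mul0r subr0 mulKf// gt_eqF.
- apply: continuous_subspaceT; exact: continuous_pj.
- have cq : continuous (fun x : R => x * qser j x).
    exact: continuous_of_is_derive (is_derive_mul_qser j).
  split.
  + by move=> x _; have [] := is_derive_mul_qser j x.
  + exact: cvg_at_right_filter (cq _).
  + exact: cvg_at_left_filter (cq _).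
- move=> x _; rewrite derive1E; exact: (@derive_val _ _ _ _ _ _ _ (is_derive_mul_qser j x)).
Qed.

Lemma pjS_zero j : pj j.+1 (0 : R) = 0.
Proof.
rewrite pjE (_ : limn (pseries _ 0) = 0) ?mulr0//; apply: cvg_lim => //.
apply: cvg_near_cst; apply: nearW => n.
rewrite /pseries /series /= big1// => -[|i] _ /=.
  by rewrite /record_coeff /= !mul0r.
by rewrite expr0n /= mulr0.
Qed.

Lemma pj_zero j : pj j (0 : R) = (j == 0%N)%:R.
Proof. by case: j => [|j]; rewrite ?pjS_zero// pj0E oppr0 expR0. Qed.

(** The two derivatives cancel. This normalisation closes the case j = 0 of the equation for a
    uniform line. *)
Lemma pj0_mul_qser0 t : pj 0 t + t * qser 0 t = 1.
Proof.
have h x : is_derive x (1 : R) (fun x => pj 0 x + x * qser 0 x) 0.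
  apply: (@is_derive_eq _ _ _ _ _ _ _ _
    (is_deriveD (is_derive_pj0 x) (is_derive_mul_qser 0 x))); ring.
by rewrite (is_derive_0_is_cst t 0 h) /= mul0r addr0 pj_zero.
Qed.

End PowerSeries.

(** * Increments up to quadratic errors *)

Section Increments.
Variable R : realType.
Implicit Types (f g : R -> R) (a b : R).

(* Halving the interval halves the quadratic term, so only the linear one survives. *)
Lemma increment_le f a b k K : a <= b -> 0 <= K ->
  (forall u v, a <= u -> u <= v -> v <= b ->
    `|f v - f u| <= (v - u) * (k + K * (v - u))) ->
  `|f b - f a| <= k * (b - a).
Proof.
move=> ab K0 hf.
have H n : forall u v, a <= u -> u <= v -> v <= b ->
    `|f v - f u| <= (v - u) * (k + K * (v - u) / 2 ^+ n).
  elim: n => [|n IH] u v au uv vb; first by rewrite expr0 divr1; exact: hf.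
  have um : u <= (u + v) / 2 by lra.
  have mv : (u + v) / 2 <= v by lra.
  have -> : f v - f u = (f v - f ((u + v) / 2)) + (f ((u + v) / 2) - f u) by lra.
  apply: (le_trans (ler_normD _ _)).
  have h1 := IH _ _ au um (le_trans mv vb).
  have h2 := IH _ _ (le_trans au um) mv vb.
  apply: (le_trans (lerD h2 h1)).
  have n0 : (2 ^+ n : R) != 0 by rewrite expf_neq0.
  by rewrite le_eqVlt; apply/orP; left; apply/eqP; rewrite exprS; field.
apply/ler_addgt0Pr => e e0.
have [n hn] : exists n, (b - a) * (K * (b - a)) / e < n%:R.
  by exists (Num.Def.archi_bound ((b - a) * (K * (b - a)) / e));
    apply: archi_boundP; rewrite divr_ge0 ?mulr_ge0 ?subr_ge0// ltW.
have := H n a b (lexx _) ab (lexx _).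
move=> /le_trans; apply; rewrite mulrDr [k * _]mulrC lerD2l.
have nn : (n%:R : R) <= 2 ^+ n by rewrite -natrX ler_nat ltnW// ltn_expl.
have p0 : (0 : R) < 2 ^+ n by rewrite exprn_gt0.
rewrite mulrA ler_pdivrMr//; move: hn; rewrite ltr_pdivrMr// => /ltW /le_trans; apply.
by rewrite mulrC ler_wpM2l// ltW.
Qed.

(** A uniqueness principle that asks no regularity of [f], which will be the difference between an
    unknown probability and its candidate. *)
Lemma increment_eq f a b K : a <= b -> 0 <= K ->
  (forall u v, a <= u -> u <= v -> v <= b -> `|f v - f u| <= K * (v - u) ^+ 2) ->
  f b = f a.
Proof.
move=> ab K0 hf; apply/eqP; rewrite -subr_eq0 -normr_le0.
rewrite -[leRHS](mul0r (b - a)); apply: (increment_le ab K0) => u v au uv vb.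
by rewrite add0r (le_trans (hf _ _ au uv vb))// expr2 mulrCA.
Qed.

Definition lip a b f := exists2 M : R, 0 <= M &
  forall u v, a <= u <= b -> a <= v <= b -> `|f v - f u| <= M * `|v - u|.

(** The points [u] and [v] come in either order, as expansions are also taken backwards from the
    right end of a step. *)
Definition tangent a b f g := exists2 K : R, 0 <= K &
  forall u v, a <= u <= b -> a <= v <= b ->
    `|f v - f u - (v - u) * g u| <= K * (v - u) ^+ 2.

Lemma lip_bounded a b f : lip a b f ->
  exists2 B : R, 0 <= B & forall u, a <= u <= b -> `|f u| <= B.
Proof.
move=> [M M0 hM]; have [ab|ba] := leP a b; last first.
  by exists 0 => // u /andP[au ub]; have := le_trans au ub; rewrite leNgt ba.
exists (`|f a| + M * (b - a)) => [|u /andP[au ub]].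
  by rewrite addr_ge0// mulr_ge0// subr_ge0.
have -> : f u = f a + (f u - f a) by rewrite addrC subrK.
apply: (le_trans (ler_normD _ _)); rewrite lerD2l.
apply: le_trans (hM a u _ _) _; rewrite ?lexx ?ab ?au ?ub//.
by rewrite ler_wpM2l// ger0_norm ?subr_ge0// lerD2r.
Qed.

Lemma lip_cst a b k : lip a b (fun=> k).
Proof. by exists 0 => // u v _ _; rewrite subrr normr0 mul0r. Qed.

Lemma lip_id a b : lip a b id.
Proof. by exists 1 => // u v _ _; rewrite mul1r. Qed.

Lemma lipD a b f g : lip a b f -> lip a b g -> lip a b (fun x => f x + g x).
Proof.
move=> [M M0 hM] [N N0 hN]; exists (M + N) => [|u v hu hv]; first exact: addr_ge0.
have -> : f v + g v - (f u + g u) = (f v - f u) + (g v - g u) by lra.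
rewrite mulrDl; apply: (le_trans (ler_normD _ _)).
by apply: lerD; [exact: hM|exact: hN].
Qed.

Lemma lipN a b f : lip a b f -> lip a b (fun x => - f x).
Proof.
move=> [M M0 hM]; exists M => // u v hu hv.
by rewrite -opprD normrN hM.
Qed.

Lemma lipM a b f g : lip a b f -> lip a b g -> lip a b (fun x => f x * g x).
Proof.
move=> lf lg; have [B B0 hB] := lip_bounded lf; have [C C0 hC] := lip_bounded lg.
move: lf lg => [M M0 hM] [N N0 hN].
exists (M * C + B * N) => [|u v hu hv]; first by rewrite addr_ge0// mulr_ge0.
have -> : f v * g v - f u * g u = (f v - f u) * g v + f u * (g v - g u) by ring.
rewrite [leRHS]mulrDl; apply: (le_trans (ler_normD _ _)); rewrite !normrM; apply: lerD.
  by rewrite [M * C * _]mulrAC; apply: ler_pM => //; [exact: hM|exact: hC].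
by rewrite -mulrA; apply: ler_pM => //; [exact: hB|exact: hN].
Qed.

Lemma lip_comp a b a' b' f g : (forall x, a <= x <= b -> a' <= g x <= b') ->
  lip a' b' f -> lip a b g -> lip a b (fun x => f (g x)).
Proof.
move=> hg [M M0 hM] [N N0 hN]; exists (M * N) => [|u v hu hv]; first exact: mulr_ge0.
by rewrite (le_trans (hM _ _ (hg _ hu) (hg _ hv)))// -mulrA ler_wpM2l// hN.
Qed.

Lemma is_derive_within a b f g :
  (forall x, a <= x <= b -> is_derive x (1 : R) f (g x)) ->
  {within `[a, b], continuous f}.
Proof.
move=> fg; apply: derivable_within_continuous => x.
by rewrite in_itv /= => /fg[].
Qed.

Lemma lip_of_derive a b f g :
  (forall x, a <= x <= b -> is_derive x (1 : R) f (g x)) ->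
  {within `[a, b], continuous g} -> lip a b f.
Proof.
move=> fg cg; have [ab|ba] := leP a b; last first.
  by exists 0 => // u v /andP[au ub]; have := le_trans au ub; rewrite leNgt ba.
have [B B0 hB] : exists2 B : R, 0 <= B & forall x, a <= x <= b -> `|g x| <= B.
  have [c _ hc] := EVT_max ab cg; have [d _ hd] := EVT_min ab cg.
  exists (`|g c| + `|g d|) => [|x xab]; first by rewrite addr_ge0.
  have /hc gc : x \in `[a, b] by rewrite in_itv.
  have /hd gd : x \in `[a, b] by rewrite in_itv.
  have := ler_norm (g c); have := ler_norm (- g d); rewrite normrN => h1 h2.
  have n1 := normr_ge0 (g c); have n2 := normr_ge0 (g d).
  by rewrite ler_norml; apply/andP; split; lra.
have H u v : a <= u <= b -> a <= v <= b -> u <= v -> `|f v - f u| <= B * `|v - u|.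
  move=> /andP[au ub] /andP[av vb] uv.
  have sub x : u <= x <= v -> a <= x <= b.
    by move=> /andP[ux xv]; rewrite (le_trans au ux) (le_trans xv vb).
  have [| |x xuv ->] := @MVT_segment _ f g u v uv.
  - by move=> x; rewrite in_itv /= => /andP[/ltW ux /ltW xv]; apply/fg/sub/andP.
  - by apply: (is_derive_within (g := g)) => x /sub /fg.
  - rewrite normrM ler_wpM2r// hB// sub//; by move: xuv; rewrite in_itv.
exists B => // u v hu hv; have [uv|vu] := leP u v; first exact: H.
by rewrite distrC [`|v - u|]distrC H// ltW.
Qed.

Lemma tangent_of_derive a b f g :
  (forall x, a <= x <= b -> is_derive x (1 : R) f (g x)) -> lip a b g ->
  tangent a b f g.
Proof.
move=> fg [M M0 hM].
(* The point [w] where the slope is taken is left free, to be either end of the interval. *)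
have H u v w : a <= u <= b -> a <= v <= b -> a <= w <= b -> u <= v ->
    `|f v - f u - (v - u) * g w| <= M * (`|u - w| + `|v - w|) * (v - u).
  move=> /andP[au ub] /andP[av vb] hw uv.
  have sub x : u <= x <= v -> a <= x <= b.
    by move=> /andP[ux xv]; rewrite (le_trans au ux) (le_trans xv vb).
  have [| |x xuv ->] := @MVT_segment _ f g u v uv.
  - by move=> x; rewrite in_itv /= => /andP[/ltW ux /ltW xv]; apply/fg/sub/andP.
  - by apply: (is_derive_within (g := g)) => x /sub /fg.
  have {}xuv : u <= x <= v by move: xuv; rewrite in_itv.
  have -> : g x * (v - u) - (v - u) * g w = (g x - g w) * (v - u) by ring.
  rewrite normrM [`|v - u|]ger0_norm ?subr_ge0// ler_wpM2r ?subr_ge0//.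
  rewrite (le_trans (hM _ _ hw (sub _ xuv)))// ler_wpM2l//.
  move: xuv => /andP[ux xv].
  have n1 := normr_ge0 (u - w); have n2 := normr_ge0 (v - w).
  have := ler_norm (v - w); have := ler_norm (- (u - w)); rewrite normrN => h1 h2.
  by rewrite ler_norml; apply/andP; split; lra.
exists M => // u v hu hv; have [uv|vu] := leP u v.
  have := H u v u hu hv hu uv; rewrite subrr normr0 add0r [`|v - u|]ger0_norm ?subr_ge0//.
  by rewrite expr2 mulrA.
have := H v u u hv hu hu (ltW vu); rewrite subrr normr0 addr0.
have -> : f u - f v - (u - v) * g u = - (f v - f u - (v - u) * g u) by ring.
have e1 : `|v - u| = u - v by rewrite distrC ger0_norm// subr_ge0 ltW.
rewrite normrN e1.
by have -> : M * (u - v) * (u - v) = M * (v - u) ^+ 2 by ring.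
Qed.

Lemma is_derive_affine f g k l (x : R) :
  (forall y, is_derive y (1 : R) f (g y)) ->
  is_derive x (1 : R) (fun y => f (k * y + l)) (k * g (k * x + l)).
Proof.
move=> fg.
have h : is_derive x (1 : R) (fun y => k * y + l) k.
  apply: (@is_derive_eq _ _ _ _ _ _ _ _ (is_deriveD
    (is_deriveM (is_derive_cst k x 1) (is_derive_id x 1)) (is_derive_cst l x 1))).
  by rewrite /GRing.scale /=; ring.
by apply: (@is_derive_eq _ _ _ _ _ _ _ _ (@is_derive1_comp R f _ x _ _ (fg _) h)); ring.
Qed.

Lemma is_derive_ext f g (x df dg : R) : f =1 g -> df = dg ->
  is_derive x (1 : R) f df -> is_derive x (1 : R) g dg.
Proof. by move=> /funext -> ->. Qed.

Lemma continuous_lip_of_derive a b f g :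
  (forall x, is_derive x (1 : R) f (g x)) -> continuous g -> lip a b f.
Proof.
move=> fg cg; apply: (lip_of_derive (fun x _ => fg x)).
exact: continuous_subspaceT.
Qed.

End Increments.

(** * Candidate laws in a rectangle and their differential equations *)

Section RecordFunctions.
Variable R : realType.
Implicit Types (a b x T : R) (i j : nat).

Lemma lip_pj a b j : lip a b (pj j : R -> R).
Proof.
case: j => [|j].
  apply: continuous_lip_of_derive (@is_derive_pj0 R) _ => x.
  by apply: continuousN; exact: continuous_pj.
apply: continuous_lip_of_derive (is_derive_pjS j) _ => x.
by apply: continuousB; [exact: continuous_qser|exact: continuous_pj].
Qed.

Lemma lip_qser a b j : lip a b (qser j : R -> R).
Proof. exact: continuous_lip_of_derive (is_derive_qser j) (@continuous_dqser R j). Qed.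

Lemma is_derive_expRNM x T :
  is_derive x (1 : R) (fun x => expR (- (x * T))) (- T * expR (- (x * T))).
Proof.
apply: is_derive_ext (is_derive_affine (- T) 0 x (@is_derive_expR R)).
  by move=> y; congr expR; ring.
by congr (_ * expR _); ring.
Qed.

Lemma lip_expRN a b T : lip a b (fun x : R => expR (- (x * T))).
Proof.
apply: continuous_lip_of_derive (is_derive_expRNM ^~ T) _.
exact: continuous_of_is_derive
  (fun x => is_deriveM (is_derive_cst (- T) x 1) (is_derive_expRNM x T)).
Qed.

(* Law of the number of records of a rectangle [[x,1] x (-T,0]] that lie to the
   left of a vertical line, for the line beyond the strip ([all_law]) and for a
   uniform line ([left_law]). *)
Definition all_law j x T : R := pj j ((1 - x) * T).
Definition left_law j x T : R :=
  x * (j == 0%N)%:R + (1 - x) * qser j ((1 - x) * T).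

(* Effect of one new atom on the left edge of the rectangle, [F] being the
   distribution function of the line: it adds a record unless the line is to its left,
   in which case nothing is counted. *)
Definition step_law (F : R -> R) (C : nat -> R -> R -> R) j x T : R :=
  if j is i.+1 then C i x T - F x * (i == 0%N)%:R else F x.

(** Primitives in T of [step_law], zero at T = 0. Times the width of a thin column, they give to
    first order the probability that the column is hit and that j records are counted. *)
Definition all_prim j x T : R := if j is i.+1 then T * qser i ((1 - x) * T) else 0.
Definition left_prim j x T : R :=
  if j is i.+1 then pj j ((1 - x) * T) + (1 - x) * T * qser j ((1 - x) * T)
  else x * T.

Lemma tangent_ext a b f g (f' g' : R -> R) : f =1 f' -> g =1 g' ->
  tangent a b f g -> tangent a b f' g'.
Proof. by move=> /funext -> /funext ->. Qed.

Lemma lip_scale M x (f : R -> R) : 0 <= x <= 1 -> 0 <= M ->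
  lip 0 M f -> lip 0 M (fun T => f ((1 - x) * T)).
Proof.
move=> /andP[x0 x1] M0 lf; apply: (lip_comp (a' := 0) (b' := M)) => //.
  move=> T /andP[T0 TM]; rewrite mulr_ge0 ?subr_ge0//=.
  by rewrite -[leRHS]mul1r ler_pM ?subr_ge0// lerBlDr lerDl.
by apply: lipM; [exact: lip_cst|exact: lip_id].
Qed.

Lemma lip_onem T (f : R -> R) : 0 <= T ->
  lip 0 T f -> lip 0 1 (fun x => f ((1 - x) * T)).
Proof.
move=> T0 lf; apply: (lip_comp (a' := 0) (b' := T)) => //.
  move=> x /andP[x0 x1]; rewrite mulr_ge0 ?subr_ge0//=.
  by rewrite -[leRHS]mul1r ler_pM ?subr_ge0// lerBlDr lerDl.
apply: lipM; last exact: lip_cst.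
by apply: lipD; [exact: lip_cst|apply: lipN; exact: lip_id].
Qed.

Lemma is_derive_scale (f f' : R -> R) x T :
  (forall y, is_derive y (1 : R) f (f' y)) ->
  is_derive T (1 : R) (fun t => f ((1 - x) * t)) ((1 - x) * f' ((1 - x) * T)).
Proof.
move=> h; apply: is_derive_ext (is_derive_affine (1 - x) 0 T h).
  by move=> y; rewrite addr0.
by rewrite addr0.
Qed.

Lemma is_derive_onem (f f' : R -> R) x T :
  (forall y, is_derive y (1 : R) f (f' y)) ->
  is_derive x (1 : R) (fun x => f ((1 - x) * T)) (- T * f' ((1 - x) * T)).
Proof.
move=> h; apply: is_derive_ext (is_derive_affine (- T) T x h).
  by move=> y; congr f; ring.
by congr (_ * f' _); ring.
Qed.

Lemma tangent_all_prim j x M : 0 <= x <= 1 -> 0 <= M ->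
  tangent 0 M (all_prim j x) (step_law (fun=> 0) all_law j x).
Proof.
move=> x01 M0; case: j => [|j].
  by exists 0 => // u v _ _; rewrite /= !mulr0 !subrr normr0 mul0r.
apply: (@tangent_ext _ _ (fun T => T * qser j ((1 - x) * T)) (fun T => all_law j x T)) => //.
  by move=> T; rewrite /= mul0r subr0.
apply: tangent_of_derive => [T _|]; last exact: lip_scale (lip_pj _ _ _).
apply: (@is_derive_eq _ _ _ _ _ _ _ _
  (is_deriveM (is_derive_id T 1) (is_derive_scale x T (is_derive_qser j)))).
rewrite /GRing.scale /= /all_law; have := mul_dqser j ((1 - x) * T).
by move=> /(congr1 (fun z => z + qser j ((1 - x) * T))); rewrite subrK => <-; ring.
Qed.

Lemma tangent_left_prim j x M : 0 <= x <= 1 -> 0 <= M ->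
  tangent 0 M (left_prim j x) (step_law id left_law j x).
Proof.
move=> x01 M0; case: j => [|j].
  by exists 0 => // u v _ _; rewrite /= (_ : _ - _ = 0) ?normr0 ?mul0r//; ring.
apply: (@tangent_ext _ _ (left_prim j.+1 x) (fun T => (1 - x) * qser j ((1 - x) * T))) => //.
  by move=> T; rewrite /= /left_law; ring.
apply: tangent_of_derive => [T _|]; last first.
  by apply: lipM; [exact: lip_cst|exact: lip_scale (lip_qser _ _ _)].
apply: (@is_derive_eq _ _ _ _ _ _ _ _ (is_deriveD
  (is_derive_scale x T (is_derive_pjS j))
  (is_derive_scale x T (is_derive_mul_qser j.+1)))).
by ring.
Qed.

(** Moving the left edge from c to d brings in exp(-(d-c)T), the probability of a void column; the
    weight exp(-xT) absorbs this factor and leaves a plain derivative. *)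
Lemma tangent_all_law j T : 0 <= T ->
  tangent 0 1 (fun x => expR (- (x * T)) * all_law j x T)
    (fun x => - (expR (- (x * T)) * all_prim j x T)).
Proof.
move=> T0; apply: tangent_of_derive => [x _|].
- case: j => [|j].
  + apply: (@is_derive_eq _ _ _ _ _ _ _ _
      (is_deriveM (is_derive_expRNM x T) (is_derive_onem x T (@is_derive_pj0 R)))).
    by rewrite /GRing.scale /= /all_law; ring.
  + apply: (@is_derive_eq _ _ _ _ _ _ _ _
      (is_deriveM (is_derive_expRNM x T) (is_derive_onem x T (is_derive_pjS j)))).
    by rewrite /GRing.scale /= /all_law; ring.
- apply: lipN; apply: lipM; first exact: lip_expRN.
  case: j => [|j] /=; first exact: lip_cst.
  by apply: lipM; [exact: lip_cst|exact: lip_onem (lip_qser _ _ _)].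
Qed.

Lemma tangent_left_law j T : 0 <= T ->
  tangent 0 1 (fun x => expR (- (x * T)) * left_law j x T)
    (fun x => - (expR (- (x * T)) * left_prim j x T)).
Proof.
move=> T0; apply: tangent_of_derive => [x _|].
- have hC : is_derive x (1 : R) (fun x => left_law j x T)
      ((j == 0%N)%:R - pj j ((1 - x) * T)).
    have h1 : is_derive x (1 : R) (fun x => 1 - x) (- 1).
      apply: (@is_derive_eq _ _ _ _ _ _ _ _
        (is_deriveB (is_derive_cst (1 : R) x 1) (is_derive_id x 1))); ring.
    apply: (@is_derive_eq _ _ _ _ _ _ _ _ (is_deriveD
      (is_deriveM (is_derive_id x 1) (is_derive_cst ((j == 0%N)%:R : R) x 1))
      (is_deriveM h1 (is_derive_onem x T (is_derive_qser j))))).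
    rewrite /GRing.scale /=; have := mul_dqser j ((1 - x) * T).
    by move=> /(congr1 (fun z => z + qser j ((1 - x) * T))); rewrite subrK => <-; ring.
  apply: (@is_derive_eq _ _ _ _ _ _ _ _ (is_deriveM (is_derive_expRNM x T) hC)).
  rewrite /GRing.scale /= /left_law; case: j {hC} => [|j] /=; last by ring.
  (* For j = 0 the constant 1 is rewritten as p_0 + t q_0 at t = (1-x)T; the terms in p_0 and q_0
     then cancel. *)
  by rewrite -[X in X - pj _ _](pj0_mul_qser0 ((1 - x) * T)); ring.
- apply: lipN; apply: lipM; first exact: lip_expRN.
  case: j => [|j] /=; first by apply: lipM; [exact: lip_id|exact: lip_cst].
  apply: lipD; first exact: lip_onem (lip_pj _ _ _).
  apply: lipM; last exact: lip_onem (lip_qser _ _ _).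
  by apply: (lip_onem (f := id)) => //; exact: lip_id.
Qed.

Lemma all_law1 j T : all_law j 1 T = (j == 0%N)%:R.
Proof. by rewrite /all_law subrr mul0r pj_zero. Qed.

Lemma left_law1 j T : left_law j 1 T = (j == 0%N)%:R.
Proof. by rewrite /left_law subrr !mul0r mul1r addr0. Qed.

Lemma all_prim0 j x : all_prim j x 0 = 0.
Proof. by case: j => [|j] /=; rewrite ?mul0r. Qed.

Lemma left_prim0 j x : left_prim j x 0 = 0.
Proof. by case: j => [|j] /=; rewrite ?mulr0// pjS_zero mul0r addr0. Qed.

End RecordFunctions.

(** * The crossing probabilities along the hyperbola *)

Section Hyperbola.
Variables (R : realType) (s : R).
Hypothesis s0 : 0 < s.
Implicit Types (b c d x : R) (i j : nat).

Definition hyp x : R := s / (1 - x).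
(** The probability that no atom lies north-west of z_x: that part of the strip has area x
    s/(1-x). *)
Definition ehyp x : R := expR (- (x * hyp x)).

(** The upper bound comes from exp(a) >= 1 + a and (1 - a + a^2)(1 + a) = 1 + a^3. *)
Lemma expRN_bounds (a : R) : 0 <= a -> 1 - a <= expR (- a) <= 1 - a + a ^+ 2.
Proof.
move=> a0; have p0 : 0 < 1 + a by rewrite ltr_pwDl.
rewrite expR_ge1Dx /= expRN.
have h : (expR a)^-1 <= (1 + a)^-1.
  by rewrite lef_pV2 ?posrE ?expR_gt0 ?expR_ge1Dx.
apply: (le_trans h); rewrite -[leRHS](@mulfK _ (1 + a)) ?gt_eqF//.
rewrite ler_peMl ?invr_ge0 ?(ltW p0)//.
have -> : (1 - a + a ^+ 2) * (1 + a) = 1 + a ^+ 3 by ring.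
by rewrite lerDl exprn_ge0.
Qed.

Lemma onem_gt0 b x : b < 1 -> x <= b -> 0 < 1 - x.
Proof. by move=> b1 xb; rewrite subr_gt0 (le_lt_trans xb). Qed.

Lemma hyp_ge0 x : x < 1 -> 0 <= hyp x.
Proof. by move=> x1; apply: divr_ge0; rewrite ?subr_ge0; exact: ltW. Qed.

Lemma le_hyp x z : x <= z -> z < 1 -> hyp x <= hyp z.
Proof.
move=> xz z1; rewrite ler_pM2l// lef_pV2 ?posrE ?subr_gt0//; last exact: le_lt_trans z1.
by rewrite lerD2l lerN2.
Qed.

Lemma hypE x : x < 1 -> (1 - x) * hyp x = s.
Proof. by move=> x1; rewrite mulrC divfK// subr_eq0 gt_eqF. Qed.

Lemma ehyp_bounds x : 0 <= x -> x < 1 -> 0 <= ehyp x <= 1.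
Proof.
by move=> x0 x1; rewrite expR_ge0 /= expR_le1 oppr_le0 mulr_ge0// hyp_ge0.
Qed.

Lemma is_derive_onemV x : x < 1 ->
  is_derive x (1 : R) (fun x => (1 - x)^-1) ((1 - x)^-1 ^+ 2).
Proof.
move=> x1; have h1 : is_derive x (1 : R) (fun x => 1 - x) (- 1).
  apply: (@is_derive_eq _ _ _ _ _ _ _ _
    (is_deriveB (is_derive_cst (1 : R) x 1) (is_derive_id x 1))); ring.
have n0 : 1 - x != 0 by rewrite subr_eq0 gt_eqF.
apply: (@is_derive_eq _ _ _ _ _ _ _ _
  (@is_deriveV _ (fun x => 1 - x) x _ 1 n0 h1)).
by rewrite /GRing.scale /= exprVn; ring.
Qed.

Definition dehyp x : R := - (s * (1 - x)^-1 ^+ 2) * ehyp x.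

Lemma is_derive_ehyp x : x < 1 -> is_derive x (1 : R) ehyp (dehyp x).
Proof.
move=> x1; have n0 : 1 - x != 0 by rewrite subr_eq0 gt_eqF.
have h : is_derive x (1 : R) (fun x => s - s * (1 - x)^-1) (- (s * (1 - x)^-1 ^+ 2)).
  apply: (@is_derive_eq _ _ _ _ _ _ _ _ (is_deriveB (is_derive_cst s x 1)
    (is_deriveM (is_derive_cst s x 1) (is_derive_onemV x1)))).
  by rewrite /GRing.scale /=; ring.
(* At z = 1 the two sides differ, because (1 - z)^-1 is then 0 by convention; the functions are
   compared only near [x] < 1. *)
have eE z : z != 1 -> expR (s - s * (1 - z)^-1) = ehyp z.
  rewrite -subr_eq0 -normr_eq0 distrC normr_eq0 => z0.
  by congr expR; rewrite /hyp; field.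
apply: (@near_eq_is_derive _ _ _ (expR \o (fun x => s - s * (1 - x)^-1)));
  rewrite ?oner_eq0//.
  near=> z; apply: eE; rewrite lt_eqF//; near: z; exact: lt_nbhsl.
apply: (@is_derive_eq _ _ _ _ _ _ _ _ (is_derive1_comp (is_derive_expR _) h)).
by rewrite eE ?lt_eqF// /dehyp mulrC.
Unshelve. all: by end_near. Qed.

Lemma lip_onemV b : b < 1 -> lip 0 b (fun x => (1 - x)^-1).
Proof.
move=> b1; exists ((1 - b)^-1 ^+ 2); first by rewrite exprn_ge0// invr_ge0 subr_ge0 ltW.
move=> u v /andP[_ ub] /andP[_ vb].
have u0 := onem_gt0 b1 ub; have v0 := onem_gt0 b1 vb.
have bb := onem_gt0 b1 (lexx b).
have -> : (1 - v)^-1 - (1 - u)^-1 = (v - u) * ((1 - v)^-1 * (1 - u)^-1).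
  by field; rewrite !gt_eqF.
have ule : (1 - u)^-1 <= (1 - b)^-1 by rewrite lef_pV2 ?posrE// lerD2l lerN2.
have vle : (1 - v)^-1 <= (1 - b)^-1 by rewrite lef_pV2 ?posrE// lerD2l lerN2.
have iu : 0 <= (1 - u)^-1 by rewrite invr_ge0 ltW.
have iv : 0 <= (1 - v)^-1 by rewrite invr_ge0 ltW.
rewrite normrM mulrC ler_wpM2r// ger0_norm ?mulr_ge0//.
by rewrite expr2 ler_pM.
Qed.

Lemma lip_hyp b : b < 1 -> lip 0 b hyp.
Proof. by move=> b1; apply: lipM; [exact: lip_cst|exact: lip_onemV]. Qed.

Lemma lip_ehyp b : b < 1 -> lip 0 b ehyp.
Proof.
move=> b1; apply: (@lip_comp _ 0 b (- hyp b) 0 expR (fun x => - (x * hyp x))).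
- move=> x /andP[x0 xb]; have x1 := le_lt_trans xb b1.
  rewrite oppr_le0 mulr_ge0 ?hyp_ge0// andbT lerN2 -[leRHS]mul1r.
  by rewrite ler_pM ?hyp_ge0 ?le_hyp// ltW.
- exact: continuous_lip_of_derive (@is_derive_expR R) (@continuous_expR R).
- by apply: lipN; apply: lipM; [exact: lip_id|exact: lip_hyp].
Qed.

Lemma lip_dehyp b : b < 1 -> lip 0 b dehyp.
Proof.
move=> b1; apply: lipM; last exact: lip_ehyp.
apply: lipN; apply: lipM; first exact: lip_cst.
by apply: lipM; exact: lip_onemV.
Qed.

Lemma tangent_ehyp b : b < 1 -> tangent 0 b ehyp dehyp.
Proof.
move=> b1; apply: tangent_of_derive (lip_dehyp b1) => x /andP[_ xb].
exact: is_derive_ehyp (le_lt_trans xb b1).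
Qed.

Lemma tangent_xehyp b : b < 1 ->
  tangent 0 b (fun x => x * ehyp x) (fun x => ehyp x + x * dehyp x).
Proof.
move=> b1; apply: tangent_of_derive => [x /andP[_ xb]|].
  apply: (@is_derive_eq _ _ _ _ _ _ _ _
    (is_deriveM (is_derive_id x 1) (is_derive_ehyp (le_lt_trans xb b1)))).
  by rewrite /GRing.scale /=; ring.
apply: lipD; first exact: lip_ehyp.
by apply: lipM; [exact: lip_id|exact: lip_dehyp].
Qed.

Lemma tangent_lin a b (f f' g g' : R -> R) (k l : R) :
  tangent a b f f' -> tangent a b g g' ->
  tangent a b (fun x => k * f x + l * g x) (fun x => k * f' x + l * g' x).
Proof.
move=> [M M0 hM] [N N0 hN]; exists (`|k| * M + `|l| * N) => [|u v hu hv].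
  by rewrite addr_ge0// mulr_ge0.
have -> : k * f v + l * g v - (k * f u + l * g u) - (v - u) * (k * f' u + l * g' u)
  = k * (f v - f u - (v - u) * f' u) + l * (g v - g u - (v - u) * g' u) by ring.
apply: (le_trans (ler_normD _ _)); rewrite !normrM [leRHS]mulrDl -!mulrA.
by apply: lerD; apply: ler_wpM2l => //; [exact: hM|exact: hN].
Qed.

End Hyperbola.

(** * The integral H *)

Section HyperbolaPrimitive.
Variables (R : realType) (s : R).
Hypothesis s0 : 0 < s.
Implicit Types (b c d x : R) (i j : nat).
Local Notation mu := (@lebesgue_measure R).
Local Notation y := (hyp s).
Local Notation e := (ehyp s).

(** H is [hint 1]. The interval is open on the right, so that the abscissa 1, where [hyp] takes a
    default value, is left out. *)
Definition hint x : R := \int[mu]_(u in `[0, x[) e u.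

Lemma integrable_ehyp u v : 0 <= u -> v <= 1 -> mu.-integrable `[u, v[ (EFin \o e).
Proof.
move=> u0 v1; apply: measurable_bounded_integrable => //.
- rewrite /= lebesgue_measure_itv /=; case: ifP => _; last exact: ltry.
  by rewrite -EFinB ltry.
  apply: (@measurable_funS _ _ _ _ (`]-oo, 1[%classic : set R)).
  + exact: measurable_itv.
  + by move=> x /=; rewrite !in_itv /= => /andP[_ xv]; exact: lt_le_trans v1.
  + apply: open_continuous_measurable_fun; first exact: interval_open.
    move=> x; rewrite inE /= in_itv /= => x1.
    apply: differentiable_continuous; apply/derivable1_diffP.
    by have [] := is_derive_ehyp s x1.
- exists 1; split; first exact: num_real.
  move=> M M1 x /=; rewrite in_itv /= => /andP[ux xv].
  have /andP[e0 e1] := ehyp_bounds s0 (le_trans u0 ux) (lt_le_trans xv v1).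
  by rewrite ger0_norm// (le_trans e1)// ltW.
Qed.

Lemma hintB u v : 0 <= u -> u <= v -> v <= 1 ->
  hint v - hint u = \int[mu]_(x in `[u, v[) e x.
Proof.
move=> u0 uv v1; rewrite /hint (@itv_bndbnd_setU _ _ (BLeft 0) (BLeft u) (BLeft v)) ?bnd_simp//.
rewrite Rintegral_setU//=; first by rewrite addrAC subrr add0r.
- rewrite -itv_bndbnd_setU ?bnd_simp//; exact: integrable_ehyp.
- apply/disj_setPS => x /=; rewrite !in_itv /= => -[/andP[_ xu] /andP[ux _]].
  by move: xu; rewrite ltNge ux.
Qed.

Lemma hint_bounds u v m M : 0 <= u -> u <= v -> v <= 1 ->
  (forall x, u <= x -> x < v -> m <= e x <= M) ->
  (v - u) * m <= hint v - hint u <= (v - u) * M.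
Proof.
move=> u0 uv v1 hm; rewrite hintB//.
have len : fine (mu `[u, v[%classic) = v - u.
  rewrite lebesgue_measure_itv /= lte_fin; move: uv; rewrite le_eqVlt.
  by move=> /predU1P[->|->] //=; rewrite ltxx subrr.
have ic k : mu.-integrable `[u, v[ (EFin \o cst k).
  apply: measurable_bounded_integrable => //; last exact: bounded_cst.
  rewrite /= lebesgue_measure_itv /=; case: ifP => _; last exact: ltry.
  by rewrite -EFinB ltry.
have itv_hm x : `[u, v[%classic x -> m <= e x <= M.
  by rewrite /= in_itv /= => /andP[ux xv]; exact: hm.
apply/andP; split.
- rewrite -len mulrC -(Rintegral_cst mu)//; apply: le_Rintegral.
  + exact: measurable_itv.
  + exact: ic.
  + exact: integrable_ehyp.
  + by move=> x /itv_hm /andP[].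
- rewrite -len mulrC -(Rintegral_cst mu)//; apply: le_Rintegral.
  + exact: measurable_itv.
  + exact: integrable_ehyp.
  + exact: ic.
  + by move=> x /itv_hm /andP[].
Qed.

Lemma hint0 : hint 0 = 0.
Proof. by rewrite /hint set_itv_ge ?Rintegral_set0// bnd_simp ltxx. Qed.

Lemma tangent_hint b : b < 1 -> tangent 0 b hint e.
Proof.
move=> b1; have [L L0 hL] := lip_ehyp s0 b1.
have H u v w : 0 <= u <= b -> 0 <= v <= b -> u <= v -> (w == u) || (w == v) ->
    `|hint v - hint u - (v - u) * e w| <= L * (v - u) ^+ 2.
  move=> /andP[uu ub] /andP[vv vb] uv hw.
  have hwb : 0 <= w <= b by case/orP : hw => /eqP ->; apply/andP.
  have := @hint_bounds u v (e w - L * (v - u)) (e w + L * (v - u)) uu uv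
    (le_trans vb (ltW b1)).
  move=> /(_ _)/andP[] => [x ux xv|h1 h2].
    have := hL w x hwb; rewrite (le_trans uu ux) (le_trans (ltW xv) vb) => /(_ isT) h.
    have hx : `|x - w| <= v - u.
      by rewrite ler_norml; case/orP : hw => /eqP ->; apply/andP; split; lra.
    have := le_trans h (ler_wpM2l L0 hx).
    by rewrite ler_norml => /andP[h1 h2]; apply/andP; split; lra.
  rewrite ler_norml expr2; apply/andP; split; nra.
exists L => // u v hu hv; have [uv|vu] := leP u v.
  by apply: H => //; rewrite eqxx.
have := H v u u hv hu (ltW vu); rewrite eqxx orbT => /(_ isT).
have -> : hint u - hint v - (u - v) * e u = - (hint v - hint u - (v - u) * e u) by ring.
by rewrite normrN -[(u - v) ^+ 2]sqrrN opprB.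
Qed.

(** Split at 1/2, where x/(1-x) = 1 and [ehyp] is exp(-s): it is at least that before and at most
    that after, so H lies between exp(-s)/2 and (1 + exp(-s))/2. *)
Lemma hint1_bounds : 0 < hint 1 < 1.
Proof.
have h2 : (0 : R) <= 2^-1 by rewrite invr_ge0.
have h3 : (2^-1 : R) <= 1 by lra.
have := @hint_bounds 0 2^-1 (expR (- s)) 1 (lexx _) h2 h3.
move=> /(_ _)/andP[] => [x x0 x2|]; rewrite ?hint0 ?subr0.
  have x1 : x < 1 by lra.
  have /andP[_ ->] := ehyp_bounds s0 x0 x1; rewrite andbT ler_expR lerN2.
  rewrite mulrCA ger_pMr// ler_pdivrMr ?subr_gt0// mul1r; lra.
have := @hint_bounds 2^-1 1 0 (expR (- s)) h2 h3 (lexx _).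
move=> /(_ _)/andP[] => [x x2 x1|].
  have x0 : 0 <= x by lra.
  have /andP[-> _] /= := ehyp_bounds s0 x0 x1; rewrite ler_expR lerN2.
  rewrite mulrCA ler_pMr// ler_pdivlMr ?subr_gt0// mul1r; lra.
have es0 := expR_gt0 (- s).
have es1 : expR (- s) < 1 by rewrite expR_lt1 oppr_lt0.
have -> : 1 - 2^-1 = 2^-1 :> R by lra.
by move=> h4 h5 h6 h7; apply/andP; split; nra.
Qed.

Lemma hint_end x : 0 <= x -> x <= 1 -> 0 <= hint 1 - hint x <= 1 - x.
Proof.
move=> x0 x1; have := @hint_bounds x 1 0 1 x0 x1 (lexx _).
rewrite mulr0 mulr1; apply => z xz z1.
by apply: (ehyp_bounds s0) => //; exact: le_trans xz.
Qed.

End HyperbolaPrimitive.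

(** * First-order expansion of a crossing step *)

Section HyperbolaStep.
Variables (R : realType) (s : R).
Hypothesis s0 : 0 < s.
Implicit Types (b c d x : R) (i j : nat).
Local Notation y := (hyp s).
Local Notation e := (ehyp s).

(* Main term of the probability that the staircase meets the hyperbola between [c]
   and [d]: on a horizontal step, then on a vertical one. *)
Definition hyp_step (C : nat -> R -> R -> R) j c d : R :=
  e c * ((1 - expR (- (c * (y d - y c)))) * C j d (y c) + C j c (y c) -
    expR (- ((d - c) * y c)) * C j d (y c)).

(** To first order the row strip has area c y'(c)(d-c) with y'(c) = s/(1-c)^2, and the column has
    area y(c)(d-c); the subtracted [C' c] comes from shifting the box from c to d. *)
Lemma hyp_step_expand (C : nat -> R -> R -> R) j (C' : R -> R) b k B :
  b < 1 -> 0 <= k -> 0 <= B ->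
  (forall c d, 0 <= c -> c <= d -> d <= b ->
    `|C j d (y c) - C j c (y c) - (d - c) * C' c| <= k * (d - c) ^+ 2) ->
  (forall c d, 0 <= c -> c <= d -> d <= b -> `|C j d (y c)| <= B) ->
  (forall c, 0 <= c <= b -> `|C' c| <= B) ->
  exists2 K : R, 0 <= K & forall c d, 0 <= c -> c <= d -> d <= b ->
    `|hyp_step C j c d - (d - c) * (e c * ((c * (s * (1 - c)^-1 ^+ 2) + y c) * C j c (y c)
      - C' c))| <= K * (d - c) ^+ 2.
Proof.
move=> b1 k0 B0 hC hB hC'.
have bb : 0 < 1 - b by rewrite subr_gt0.
pose m := (1 - b)^-1; have m0 : 0 <= m by rewrite invr_ge0 ltW.
pose A := s * m ^+ 2 + s * m.
have A0 : 0 <= A by rewrite addr_ge0 ?mulr_ge0 ?exprn_ge0 ?(ltW s0).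
have sm0 : 0 <= s * m by rewrite mulr_ge0 ?(ltW s0).
have sm20 : 0 <= s * m ^+ 2 by rewrite mulr_ge0 ?exprn_ge0 ?(ltW s0).
have sm30 : 0 <= s * m ^+ 3 by rewrite mulr_ge0 ?exprn_ge0 ?(ltW s0).
(* (s m^2)^2 and (s m)^2 bound the second-order terms of the two exponentials, s m^3 the
   linearisation of y, A (k + B) the replacement of C at d by C at c, and k the expansion of C; m
   bounds (1 - x)^-1 on [0, b]. *)
exists (((s * m ^+ 2) ^+ 2 + s * m ^+ 3 + (s * m) ^+ 2) * B + A * (k + B) + k).
  by rewrite addr_ge0// addr_ge0// mulr_ge0 ?addr_ge0// exprn_ge0.
move=> c d c0 cd db; have d1 := le_lt_trans db b1; have c1 := le_lt_trans cd d1.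
have /andP[ce0 ce1] : 0 <= e c <= 1 by exact: ehyp_bounds.
have cle1 : c <= 1 by exact: ltW.
pose dl := d - c; have dl0 : 0 <= dl by rewrite subr_ge0.
have dl1 : dl <= 1 by rewrite /dl; lra.
pose n := (1 - c)^-1; pose l := (1 - d)^-1.
have cc : 0 < 1 - c by rewrite subr_gt0.
have dd : 0 < 1 - d by rewrite subr_gt0.
have n0 : 0 <= n by rewrite invr_ge0 ltW.
have l0 : 0 <= l by rewrite invr_ge0 ltW.
have nm : n <= m by rewrite lef_pV2 ?posrE//; lra.
have lm : l <= m by rewrite lef_pV2 ?posrE//; lra.
have ydE : y d - y c = s * (n * l) * dl.
  by rewrite /hyp /n /l /dl; field; rewrite !gt_eqF.
pose a1 := c * (y d - y c); pose a2 := dl * y c.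
have nl0 : 0 <= n * l by rewrite mulr_ge0.
have snl0 : 0 <= s * (n * l) by rewrite mulr_ge0 ?(ltW s0).
have nlm : n * l <= m ^+ 2 by rewrite expr2; exact: ler_pM.
have a10 : 0 <= a1 by rewrite /a1 ydE; do 2 apply: mulr_ge0 => //.
have a20 : 0 <= a2 by rewrite /a2 mulr_ge0// hyp_ge0.
have a1m : a1 <= s * m ^+ 2 * dl.
  rewrite /a1 ydE; have p0 : 0 <= s * (n * l) * dl by rewrite mulr_ge0.
  apply: le_trans (ler_piMl p0 cle1) _.
  by rewrite ler_wpM2r// ler_pM2l.
have a2m : a2 <= s * m * dl by rewrite /a2 mulrC ler_wpM2r// ler_pM2l.
have sq (u v : R) : 0 <= u -> u <= v * dl -> u ^+ 2 <= v ^+ 2 * dl ^+ 2.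
  by move=> u0 uv; rewrite -exprMn !expr2 ler_pM.
have t1 : `|1 - expR (- a1) - a1| <= (s * m ^+ 2) ^+ 2 * dl ^+ 2.
  have /andP[h1 h2] := expRN_bounds a10; have h3 := sq _ _ a10 a1m.
  have h4 : 0 <= a1 ^+ 2 by rewrite exprn_ge0.
  by rewrite ler_norml; apply/andP; split; lra.
have t3 : `|1 - expR (- a2) - a2| <= (s * m) ^+ 2 * dl ^+ 2.
  have /andP[h1 h2] := expRN_bounds a20; have h3 := sq _ _ a20 a2m.
  have h4 : 0 <= a2 ^+ 2 by rewrite exprn_ge0.
  by rewrite ler_norml; apply/andP; split; lra.
pose D := c * (s * n ^+ 2).
have t2 : `|a1 - dl * D| <= s * m ^+ 3 * dl ^+ 2.
  have -> : a1 - dl * D = c * (s * (n * l * n) * dl ^+ 2).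
    by rewrite /a1 ydE /D /n /l /dl; field; rewrite !gt_eqF.
  have p0 : 0 <= s * (n * l * n) * dl ^+ 2.
    by rewrite mulr_ge0 ?exprn_ge0// mulr_ge0 ?(ltW s0)// mulr_ge0.
  rewrite ger0_norm; last exact: mulr_ge0.
  apply: le_trans (ler_piMl p0 cle1) _.
  by rewrite ler_wpM2r ?exprn_ge0// ler_pM2l// [m ^+ 3]exprSr ler_pM.
have DA : `|D + y c| <= A.
  rewrite ger0_norm; last by rewrite addr_ge0 ?hyp_ge0// !mulr_ge0 ?exprn_ge0 ?(ltW s0).
  rewrite lerD//; last by rewrite /hyp ler_pM2l.
  have p0 : 0 <= s * n ^+ 2 by rewrite mulr_ge0 ?exprn_ge0 ?(ltW s0).
  by apply: le_trans (ler_piMl p0 cle1) _; rewrite ler_pM2l// !expr2 ler_pM.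
have hCd := hB c d c0 cd db.
have h5 := hC c d c0 cd db; rewrite -/dl in h5.
have h6 : `|C' c| <= B by rewrite hC'// c0 (le_trans cd).
have t4 : `|C j d (y c) - C j c (y c)| <= dl * (k + B).
  have -> : C j d (y c) - C j c (y c) =
    (C j d (y c) - C j c (y c) - dl * C' c) + dl * C' c by ring.
  rewrite mulrDr; apply: le_trans (ler_normD _ _) _; apply: lerD.
    apply: le_trans h5 _; rewrite mulrC ler_wpM2r//.
    by rewrite expr2 -[leRHS]mul1r ler_wpM2r.
  by rewrite normrM (ger0_norm dl0) ler_wpM2l.
rewrite /hyp_step -/a1 -/dl -/a2 -/n -/D.
have -> : e c * ((1 - expR (- a1)) * C j d (y c) + C j c (y c) - expR (- a2) * C j d (y c))
   - dl * (e c * ((D + y c) * C j c (y c) - C' c)) =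
  e c * ((1 - expR (- a1) - a1) * C j d (y c) + (a1 - dl * D) * C j d (y c)
   + (1 - expR (- a2) - a2) * C j d (y c)
   + dl * (D + y c) * (C j d (y c) - C j c (y c))
   - (C j d (y c) - C j c (y c) - dl * C' c)) by rewrite /a2; ring.
rewrite normrM (ger0_norm ce0); apply: le_trans (ler_piMl (normr_ge0 _) ce1) _.
rewrite [leRHS](_ : _ = (s * m ^+ 2) ^+ 2 * dl ^+ 2 * B + s * m ^+ 3 * dl ^+ 2 * B
  + (s * m) ^+ 2 * dl ^+ 2 * B + A * (k + B) * dl ^+ 2 + k * dl ^+ 2); last by ring.
apply: le_trans (ler_normB _ _) _; apply: lerD => //.
apply: le_trans (ler_normD _ _) _; apply: lerD; last first.
  rewrite !normrM (ger0_norm dl0).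
  apply: le_trans (ler_pM _ _ (ler_pM _ _ (lexx dl) DA) t4) _ => //.
    by rewrite mulr_ge0.
  by rewrite le_eqVlt; apply/orP; left; apply/eqP; ring.
apply: le_trans (ler_normD _ _) _; apply: lerD.
  apply: le_trans (ler_normD _ _) _; apply: lerD; rewrite normrM.
    by apply: le_trans (ler_pM _ _ t1 hCd) _ => //.
  by apply: le_trans (ler_pM _ _ t2 hCd) _ => //.
by rewrite normrM; apply: le_trans (ler_pM _ _ t3 hCd) _ => //.
Qed.

End HyperbolaStep.

(** * Explicit crossing probabilities *)

Section HyperbolaLaws.
Variables (R : realType) (s : R).
Hypothesis s0 : 0 < s.
Implicit Types (b c d x : R) (i j : nat).
Local Notation y := (hyp s).
Local Notation e := (ehyp s).
Local Notation h := (hint s).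

(** The integrals over [x,1] of -e'(u) and of -u e'(u) are e(x) and, by parts, x e(x) + h 1 - h x.
    The probabilities sought combine these with the integral of e itself; subtracting h 1 makes all
    three terms tend to 0 at x = 1. *)
Definition hyp_fun (k l m : R) x : R := k * e x + l * (x * e x) + m * (h x - h 1).

Lemma tangent_hyp_fun k l m b : b < 1 -> tangent 0 b (hyp_fun k l m)
  (fun x => k * dehyp s x + l * (e x + x * dehyp s x) + m * e x).
Proof.
move=> b1.
have t1 := tangent_lin k l (tangent_ehyp s0 b1) (tangent_xehyp s0 b1).
have [K K0 hK] := tangent_lin 1 m t1 (tangent_hint s0 b1).
exists K => // u v hu hv; have := hK u v hu hv; rewrite /hyp_fun.
by congr (`|_| <= _); ring.
Qed.

(** exp(-z) <= 1/z at z = x s/(1-x), with x kept away from 0 by the bound 1/2. *)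
Lemma ehyp_end x : 2^-1 <= x -> x < 1 -> e x <= 2 / s * (1 - x).
Proof.
move=> x2 x1; have x0 : 0 < x by lra.
have z0 : 0 < x * y x by rewrite mulr_gt0// divr_gt0// subr_gt0.
rewrite /ehyp expRN; apply: (@le_trans _ _ (x * y x)^-1).
  rewrite lef_pV2 ?posrE ?expR_gt0//.
  by apply: le_trans (expR_ge1Dx _); rewrite lerDr.
have -> : (x * y x)^-1 = x^-1 * (s^-1 * (1 - x)).
  by rewrite /hyp; field; rewrite !gt_eqF// subr_gt0.
rewrite -mulrA ler_wpM2r// ?mulr_ge0 ?invr_ge0 ?subr_ge0 ?(ltW s0) ?(ltW x1)//.
by rewrite -[leRHS]invrK lef_pV2 ?posrE ?invr_gt0.
Qed.

Lemma hyp_fun_end k l m x : 2^-1 <= x -> x < 1 ->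
  `|hyp_fun k l m x| <= ((`|k| + `|l|) * (2 / s) + `|m|) * (1 - x).
Proof.
move=> x2 x1; have x0 : 0 <= x by lra.
have he := ehyp_end x2 x1.
have /andP[e0 e1] := ehyp_bounds s0 x0 x1.
have /andP[h0 h1] := hint_end s0 x0 (ltW x1).
rewrite mulrDl; apply: le_trans (ler_normD _ _) _; apply: lerD; last first.
  by rewrite normrM ler_wpM2l// distrC ger0_norm.
rewrite -mulrA mulrDl; apply: le_trans (ler_normD _ _) _.
apply: lerD; rewrite normrM ler_wpM2l// ger0_norm ?mulr_ge0//.
by apply: le_trans (ler_piMl e0 (ltW x1)) he.
Qed.

(** The value 0 at j = 0 reflects that a meeting on a vertical step leaves at least one record. *)
Definition qpred j : R := if j is i.+1 then qser i s else 0.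

(** The integral over [x,1] of -e'(u) (u p_j(s) + (1-u) q_{j-1}(s)), a meeting at abscissa u being
    horizontal with probability u. *)
Definition all_phi j := hyp_fun (qpred j) (pj j s - qpred j) (qpred j - pj j s).
(** The integral over [x,1] of -e'(u) (u [j=0] + (1-u) q_j(s)) - e(u) ([j=0] - p_j(s)). The
    correction is the derivative of [left_law] in its first variable, which [hyp_step] picks up. *)
Definition left_phi j :=
  hyp_fun (qser j s) ((j == 0%N)%:R - qser j s) (qser j s - pj j s).

Lemma all_phi0 j : all_phi j 0 = h 1 * pj j s + (1 - h 1) * qpred j.
Proof. by rewrite /all_phi /hyp_fun hint0 /ehyp mul0r oppr0 expR0; ring. Qed.

Lemma left_phi0 j : left_phi j 0 = h 1 * pj j s + (1 - h 1) * qser j s.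
Proof. by rewrite /left_phi /hyp_fun hint0 /ehyp mul0r oppr0 expR0; ring. Qed.

Lemma phi_step_of_expand (C : nat -> R -> R -> R) j (C' : R -> R) k l m b L B :
  b < 1 -> 0 <= L -> 0 <= B ->
  (forall c d, 0 <= c -> c <= d -> d <= b ->
    `|C j d (y c) - C j c (y c) - (d - c) * C' c| <= L * (d - c) ^+ 2) ->
  (forall c d, 0 <= c -> c <= d -> d <= b -> `|C j d (y c)| <= B) ->
  (forall c, 0 <= c <= b -> `|C' c| <= B) ->
  (forall c, 0 <= c <= b ->
    k * dehyp s c + l * (e c + c * dehyp s c) + m * e c =
    - (e c * ((c * (s * (1 - c)^-1 ^+ 2) + y c) * C j c (y c) - C' c))) ->
  exists2 K : R, 0 <= K & forall c d, 0 <= c -> c <= d -> d <= b ->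
    `|hyp_fun k l m c - hyp_fun k l m d - hyp_step s C j c d| <= K * (d - c) ^+ 2.
Proof.
move=> b1 L0 B0 h1 h2 h3 h4.
have [K K0 hK] := hyp_step_expand s0 b1 L0 B0 h1 h2 h3.
have [N N0 hN] := tangent_hyp_fun k l m b1.
exists (N + K) => [|c d c0 cd db]; first exact: addr_ge0.
have hc : 0 <= c <= b by rewrite c0 (le_trans cd).
have hd : 0 <= d <= b by rewrite db (le_trans c0).
have := hN c d hc hd; rewrite h4// => h5; have h6 := hK c d c0 cd db.
rewrite mulrDl; apply: le_trans (lerD h5 h6); apply: le_trans (ler_normD _ _).
rewrite -[leLHS]normrN le_eqVlt; apply/orP; left; apply/eqP.
by congr (`|_|); ring.
Qed.

Lemma scaled_onem c d : c <= d -> d < 1 -> (1 - d) * y c = s - (d - c) * y c.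
Proof.
move=> cd d1; have -> : (1 - d) * y c = (1 - c) * y c - (d - c) * y c by ring.
by rewrite hypE// (le_lt_trans cd).
Qed.

Lemma scaled_bounds b c d : b < 1 -> 0 <= c -> c <= d -> d <= b ->
  0 <= (1 - d) * y c <= s /\ 0 <= y c <= y b.
Proof.
move=> b1 c0 cd db; have d1 := le_lt_trans db b1; have c1 := le_lt_trans cd d1.
have y0 := hyp_ge0 s0 c1; split; last by rewrite y0 le_hyp// (le_trans cd).
rewrite mulr_ge0 ?subr_ge0 ?(ltW d1)//= scaled_onem// lerBlDr lerDl.
by rewrite mulr_ge0// subr_ge0.
Qed.

Lemma is_derive_pj j (t : R) : is_derive t (1 : R) (pj j)
  ((if j is i.+1 then qser i t else 0) - pj j t).
Proof.
case: j => [|j]; last exact: is_derive_pjS.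
by rewrite sub0r; exact: is_derive_pj0.
Qed.

(** The box at z_c has area s, and shifting its left side to d removes the area (d-c) y(c); hence
    the expansion at s. *)
Lemma scaled_tangent (f g : R -> R) b : b < 1 -> tangent 0 s f g ->
  exists2 L : R, 0 <= L & forall c d, 0 <= c -> c <= d -> d <= b ->
    `|f ((1 - d) * y c) - f s + (d - c) * (y c * g s)| <= L * (d - c) ^+ 2.
Proof.
move=> b1 [K K0 hK]; exists (K * y b ^+ 2) => [|c d c0 cd db].
  by rewrite mulr_ge0// exprn_ge0// hyp_ge0.
have [ht /andP[yc0 ycb]] := scaled_bounds b1 c0 cd db.
have hs : 0 <= s <= s by rewrite lexx ltW.
have := hK s _ hs ht; rewrite scaled_onem//; last exact: le_lt_trans b1.
have -> : f (s - (d - c) * y c) - f s - (s - (d - c) * y c - s) * g s =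
  f (s - (d - c) * y c) - f s + (d - c) * (y c * g s) by ring.
move=> /le_trans; apply; rewrite -mulrA ler_wpM2l//.
have -> : (s - (d - c) * y c - s) ^+ 2 = y c ^+ 2 * (d - c) ^+ 2 by ring.
by rewrite ler_wpM2r ?exprn_ge0 ?subr_ge0// !expr2 ler_pM.
Qed.

Lemma all_phi_step j b : b < 1 ->
  exists2 K : R, 0 <= K & forall c d, 0 <= c -> c <= d -> d <= b ->
    `|all_phi j c - all_phi j d - hyp_step s (@all_law R) j c d| <= K * (d - c) ^+ 2.
Proof.
move=> b1.
have tp : tangent 0 s (pj j) (fun t => (if j is i.+1 then qser i t else 0) - pj j t).
  apply: tangent_of_derive => [x _|]; first exact: is_derive_pj.
  apply: lipD; last by apply: lipN; exact: lip_pj.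
  by case: (j) => [|i]; [exact: lip_cst|exact: lip_qser].
have [L L0 hL] := scaled_tangent b1 tp.
have [B B0 hB] := lip_bounded (lip_pj 0 s j).
have qpE : (if j is i.+1 then qser i s else 0) = qpred j by [].
apply: (@phi_step_of_expand _ _ (fun c => - (y c * (qpred j - pj j s))) _ _ _ _ L
  (B + y b * `|qpred j - pj j s|)) => //.
- by rewrite addr_ge0// mulr_ge0// hyp_ge0.
- move=> c d c0 cd db; have := hL c d c0 cd db.
  by rewrite qpE /all_law hypE ?mulrN ?opprK// (le_lt_trans cd)// (le_lt_trans db).
- move=> c d c0 cd db; have [h1 _] := scaled_bounds b1 c0 cd db.
  rewrite /all_law; apply: le_trans (hB _ h1) _.
  by rewrite lerDl mulr_ge0// hyp_ge0.
- move=> c /andP[c0 cb]; have [_ /andP[yc0 ycb]] := scaled_bounds b1 c0 (lexx c) cb.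
  by rewrite normrN normrM (ger0_norm yc0) -[leLHS]add0r lerD// ler_wpM2r.
- move=> c /andP[c0 cb]; have c1 := le_lt_trans cb b1.
  rewrite /all_law hypE// /dehyp /hyp; field.
  by rewrite subr_eq0 gt_eqF.
Qed.

Lemma left_phi_step j b : b < 1 ->
  exists2 K : R, 0 <= K & forall c d, 0 <= c -> c <= d -> d <= b ->
    `|left_phi j c - left_phi j d - hyp_step s (@left_law R) j c d| <= K * (d - c) ^+ 2.
Proof.
move=> b1; have s00 := ltW s0.
have tp : tangent 0 s (fun t => t * qser j t) (pj j).
  apply: tangent_of_derive (lip_pj _ _ _) => x _; exact: is_derive_mul_qser.
have [L L0 hL] := scaled_tangent b1 tp.
have [B B0 hB] := lip_bounded (lip_qser 0 s j).
pose J : R := (j == 0%N)%:R; have J0 : 0 <= J by [].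
apply: (@phi_step_of_expand _ _ (fun=> J - pj j s) _ _ _ _ (L / s)
  (J + B + `|pj j s|)) => //.
- by rewrite mulr_ge0 ?invr_ge0.
- by rewrite !addr_ge0.
- move=> c d c0 cd db; have d1 := le_lt_trans db b1; have c1 := le_lt_trans cd d1.
  have cc : 0 < 1 - c by rewrite subr_gt0.
  have := hL c d c0 cd db; set t := (1 - d) * y c => h1.
  (* As 1 - d = (1 - c)/s * t, the factor 1 - d turns q_j(t) into t q_j(t), whose derivative is
     p_j. *)
  have -> : left_law j d (y c) - left_law j c (y c) - (d - c) * (J - pj j s) =
      (1 - c) / s * (t * qser j t - s * qser j s + (d - c) * (y c * pj j s)).
    rewrite /left_law -/J -/t hypE//.
    rewrite {2}/t /hyp; field; by rewrite !gt_eqF.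
  have k0 : 0 <= (1 - c) / s by rewrite divr_ge0// ltW.
  have kle : (1 - c) / s <= s^-1.
    by rewrite ler_piMl ?invr_ge0// lerBlDr lerDl.
  rewrite normrM (ger0_norm k0) [L / s]mulrC -[leRHS]mulrA.
  by apply: ler_pM.
- move=> c d c0 cd db; have [h1 _] := scaled_bounds b1 c0 cd db.
  have d1 := le_lt_trans db b1; have d0 := le_trans c0 cd.
  rewrite /left_law -/J; apply: le_trans (ler_normD _ _) _.
  rewrite -[leLHS]addr0 lerD// lerD//.
    by rewrite ger0_norm ?mulr_ge0// ler_piMl// ltW.
  have dd : 0 <= 1 - d by rewrite subr_ge0 ltW.
  rewrite normrM (ger0_norm dd); apply: le_trans (hB _ h1).
  by rewrite ler_piMl// lerBlDr lerDl.
- move=> c _; apply: le_trans (ler_normB _ _) _; rewrite (ger0_norm J0).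
  by rewrite lerD2r lerDl.
- move=> c /andP[c0 cb]; have c1 := le_lt_trans cb b1.
  rewrite /left_law hypE// /dehyp /hyp -/J; field.
  by rewrite subr_eq0 gt_eqF.
Qed.

End HyperbolaLaws.

(** * Void events and independence *)

Local Open Scope card_scope.

(* A vertical line [x = beta] thrown independently onto the Poisson process;
   [F x] is the probability that it falls to the left of [x]. *)
Record line_process (R : realType) (d : measure_display) (Om : measurableType d)
    (P : probability Om R) (Pi : Om -> set (R * R)) (beta : Om -> R)
    (F : R -> R) : Prop := LineProcess {
  lp_strip : forall w, Pi w `<=` strip;
  lp_fin : forall w (n : nat), finite_set (Pi w `&` [set a | - n%:R <= a.2]);
  lp_meas : forall B k, admissible B -> measurable (count_event Pi B k);
  lp_count : forall B k, admissible B -> P (count_event Pi B k) =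
     (expR (- fine (area B)) * fine (area B) ^+ k / k`!%:R)%:E;
  lp_beta : measurable_fun setT beta;
  lp_indep : forall A B, measurable A -> admissible B ->
    P (beta @^-1` A `&` count_event Pi B 0) =
    (P (beta @^-1` A) * P (count_event Pi B 0))%E;
  lp_F : forall x, 0 <= x <= 1 -> P (beta @^-1` `]-oo, x[%classic) = (F x)%:E;
  lp_lip : forall c d, 0 <= c -> c <= d -> d <= 1 -> F d - F c <= d - c }.

Section Probability.
Context {R : realType} {d : measure_display} {Om : measurableType d}.
Variable P : probability Om R.
Implicit Types (A B : set Om).

Definition pr A : R := fine (P A).

Lemma prE A : measurable A -> P A = (pr A)%:E.
Proof. by move=> mA; rewrite fineK// fin_num_measure. Qed.

Lemma pr_ge0 A : 0 <= pr A.
Proof. exact: fine_ge0. Qed.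

Lemma pr_le A B : measurable A -> measurable B -> A `<=` B -> pr A <= pr B.
Proof.
by move=> mA mB AB; rewrite -lee_fin -!prE//; apply: le_measure => //; rewrite inE.
Qed.

Lemma pr_le1 A : measurable A -> pr A <= 1.
Proof. by move=> mA; rewrite -lee_fin -prE// probability_le1. Qed.

Lemma pr_split A B : measurable A -> measurable B ->
  pr A = pr (A `&` B) + pr (A `&` ~` B).
Proof.
move=> mA mB; have mC := measurableC mB.
apply: EFin_inj; rewrite EFinD -!prE//; try exact: measurableI.
rewrite -measureU//; try exact: measurableI.
  by rewrite -setIUr setUv setIT.
by rewrite setIACA setICr setI0.
Qed.

Lemma pr_setT : pr setT = 1.
Proof. by rewrite /pr probability_setT. Qed.

Lemma pr_setC A : measurable A -> pr (~` A) = 1 - pr A.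
Proof.
move=> mA; have := pr_split measurableT mA.
by rewrite pr_setT !setTI => ->; rewrite addrC addKr.
Qed.

Lemma pr_setU_le A B : measurable A -> measurable B -> pr (A `|` B) <= pr A + pr B.
Proof.
move=> mA mB; have mU := measurableU _ _ mA mB.
rewrite (pr_split mU mA) setUK lerD2l pr_le//.
  by apply: measurableI => //; exact: measurableC.
by move=> w [[]].
Qed.

(** [B] is the exceptional event. Outside it A is the disjoint union of A1 and A2; inside it A
    counts at most once, and A1 and A2 at most twice in all. *)
Lemma pr_approx A A1 A2 B : measurable A -> measurable A1 -> measurable A2 ->
  measurable B -> (forall w, ~ B w -> A w <-> A1 w \/ A2 w) ->
  (forall w, ~ B w -> A1 w -> ~ A2 w) ->
  `|pr A - (pr A1 + pr A2)| <= 2 * pr B.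
Proof.
move=> mA m1 m2 mB hA h12; have mC := measurableC mB.
have mI E : measurable E -> measurable (E `&` ~` B) by move=> ?; exact: measurableI.
have mJ E : measurable E -> measurable (E `&` B) by move=> ?; exact: measurableI.
have le E : measurable E -> 0 <= pr (E `&` B) <= pr B.
  by move=> mE; rewrite pr_ge0/= pr_le//; exact: mJ.
have eqA : pr (A `&` ~` B) = pr (A1 `&` ~` B) + pr (A2 `&` ~` B).
  apply: EFin_inj; rewrite EFinD -!prE//; try exact: mI.
  rewrite -measureU; [|exact: mI|exact: mI|].
    congr (P _); apply/seteqP; split => w /=.
      by move=> [/(hA _ _)H nB]; have [] := H nB; [left|right].
    by move=> [[h nB]|[h nB]]; split => //; apply/hA => //; [left|right].
  by apply/seteqP; split => w //= [[h1 nB] [h2 _]]; exact: h12 nB h1 h2.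
rewrite (pr_split mA mB) (pr_split m1 mB) (pr_split m2 mB) eqA.
move: (le _ mA) (le _ m1) (le _ m2) => /andP[? ?] /andP[? ?] /andP[? ?].
by rewrite ler_norml; apply/andP; split; lra.
Qed.

End Probability.

(** * Events observable from a region and the line *)

Section Observation.
Context {R : realType} {d : measure_display} {Om : measurableType d}.
Variables (P : probability Om R) (Pi : Om -> set (R * R)) (beta : Om -> R).
Variable F : R -> R.
Hypothesis LP : line_process P Pi beta F.
Implicit Types (B C Q : set (R * R)) (E : set Om).

Definition void B : set Om := [set w | Pi w `&` B = set0].

Lemma voidE B : void B = count_event Pi B 0.
Proof.
rewrite /void /count_event II0; apply/seteqP; split => w /=.
  by move=> ->; rewrite card_eq0 eqxx.
by rewrite card_eq0 => /eqP.
Qed.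

Lemma admissible0 : @admissible R set0.
Proof. by split; [exact: measurable0|split => //; rewrite /area measure0]. Qed.

Lemma admissibleU B C : admissible B -> admissible C -> admissible (B `|` C).
Proof.
move=> [mB [Bs Ba]] [mC [Cs Ca]]; split; first exact: measurableU.
split; first by move=> a [/Bs|/Cs].
by apply: (@le_lt_trans _ _ (area B + area C)%E); [exact: measureU2|exact: lte_add_pinfty].
Qed.

Lemma voidU B C : void (B `|` C) = void B `&` void C.
Proof.
apply/seteqP; split => w /=; rewrite /void /= setIUr.
  by rewrite setU_eq0.
by move=> [-> ->]; rewrite setU0.
Qed.

Lemma measurable_void B : admissible B -> measurable (void B).
Proof. by move=> aB; rewrite voidE; exact: (lp_meas LP). Qed.

Lemma pr_void B : admissible B -> pr P (void B) = expR (- fine (area B)).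
Proof. by move=> aB; rewrite /pr voidE (lp_count LP)//= expr0 mulr1 divr1. Qed.

(** Areas add, so exp(-area) multiplies: this is how independence of disjoint regions enters. *)
Lemma pr_voidU B C : admissible B -> admissible C -> B `&` C = set0 ->
  pr P (void (B `|` C)) = pr P (void B) * pr P (void C).
Proof.
move=> aB aC BC; rewrite !pr_void//; last exact: admissibleU.
move: aB aC => [mB [_ fB]] [mC [_ fC]].
rewrite -expRD -opprD; congr (expR (- _)).
rewrite /area measureU// fineD//; rewrite ge0_fin_numE//.
Qed.

(** Generators of the events decided by the line and by the atoms in [Q]. Void events are enough,
    since record counts will be expressed through them. *)
Definition obs_gen Q : set (set Om) := [set E | exists A B, [/\ measurable A,
  admissible B, B `<=` Q & E = beta @^-1` A `&` void B]].

Definition obs Q E : Prop := @measurable _ (g_sigma_algebraType (obs_gen Q)) E.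

Lemma measurable_beta A : measurable A -> measurable (beta @^-1` A).
Proof.
by move=> mA; rewrite -[X in measurable X]setTI; exact: (lp_beta LP).
Qed.

Lemma obs_measurable Q E : obs Q E -> measurable E.
Proof.
apply: smallest_sub; first exact: sigma_algebra_measurable.
move=> _ [A [B [mA aB _ ->]]]; apply: measurableI; last exact: measurable_void.
exact: measurable_beta.
Qed.

Lemma obsS Q Q' E : Q `<=` Q' -> obs Q E -> obs Q' E.
Proof.
move=> QQ'; apply: sub_sigma_algebra2 => {}E [A [B [mA aB BQ ->]]].
by exists A, B; split => //; exact: subset_trans QQ'.
Qed.

Lemma obs_beta Q A : measurable A -> obs Q (beta @^-1` A).
Proof.
move=> mA; apply: sub_sigma_algebra; exists A, set0; split => //.
  exact: admissible0.
by apply/seteqP; split => w /=; rewrite /void /= setI0; [split|case].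
Qed.

Lemma obs_void Q B : admissible B -> B `<=` Q -> obs Q (void B).
Proof.
move=> aB BQ; apply: sub_sigma_algebra; exists setT, B; split => //.
by rewrite preimage_setT setTI.
Qed.

Lemma obsI Q E E' : obs Q E -> obs Q E' -> obs Q (E `&` E').
Proof. exact: measurableI. Qed.

Lemma obsU Q E E' : obs Q E -> obs Q E' -> obs Q (E `|` E').
Proof. exact: measurableU. Qed.

Lemma obsC Q E : obs Q E -> obs Q (~` E).
Proof. exact: measurableC. Qed.

Lemma obs_bigcup Q (I : countType) (E : I -> set Om) :
  (forall i, obs Q (E i)) -> obs Q (\bigcup_i E i).
Proof. by apply: countable_bigcupT_measurable; exact: countableP. Qed.

Lemma obs_bigcap Q (I : countType) (E : I -> set Om) :
  (forall i, obs Q (E i)) -> obs Q (\bigcap_i E i).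
Proof.
move=> h; rewrite -[X in obs _ X]setCK setC_bigcap; apply: obsC.
by apply: obs_bigcup => i; exact: obsC.
Qed.

(* The generating events form a pi-system because intersecting two void events
   gives the void event of the union. *)
Lemma obs_indep Q B E : admissible B -> B `&` Q = set0 -> obs Q E ->
  pr P (void B `&` E) = pr P (void B) * pr P E.
Proof.
move=> aB BQ oE; have mE := obs_measurable oE; have mB := measurable_void aB.
have r0 : 0 <= pr P (void B) by exact: pr_ge0.
have H : mrestr P mB E = mscale (NngNum r0) P E.
  apply: (@g_sigma_algebra_measure_unique _ _ _ (obs_gen Q) _ (fun=> setT)) oE.
  - by move=> G [A [C [mA aC _ ->]]]; apply: measurableI;
      [exact: measurable_beta|exact: measurable_void].
  - move=> _; exists setT, set0; split => //; first exact: admissible0.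
    by rewrite preimage_setT setTI; apply/seteqP; split => w //= _; rewrite /void /= setI0.
  - by rewrite bigcup_const.
  - move=> _ _ [A1 [B1 [m1 a1 s1 ->]]] [A2 [B2 [m2 a2 s2 ->]]].
    exists (A1 `&` A2), (B1 `|` B2); split.
    + exact: measurableI.
    + exact: admissibleU.
    + by move=> a [/s1|/s2].
    + by rewrite setIACA voidU.
  - move=> _ [A [C [mA aC CQ ->]]].
    have dBC : B `&` C = set0.
      by apply/seteqP; split => // a [Ba /CQ Qa]; rewrite -BQ.
    change (P ((beta @^-1` A `&` void C) `&` void B) =
      ((pr P (void B))%:E * P (beta @^-1` A `&` void C))%E).
    rewrite -setIA -voidU !voidE.
    have aU := admissibleU aC aB.
    rewrite !(lp_indep LP)// -!voidE muleCA; congr (_ * _)%E.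
    rewrite !prE; [|exact: measurable_void|exact: measurable_void].
    by rewrite setUC pr_voidU.
  - by move=> _; change (P (setT `&` void B) < +oo)%E; rewrite setTI prE// ltry.
move: H; change (P (E `&` void B) = ((pr P (void B))%:E * P E)%E -> 
  pr P (void B `&` E) = pr P (void B) * pr P E); rewrite setIC.
by rewrite [P (_ `&` _)]prE ?[P E]prE//; [case|exact: measurableI].
Qed.

Definition hit B : set Om := ~` void B.

Lemma obs_hit Q B : admissible B -> B `<=` Q -> obs Q (hit B).
Proof. by move=> aB BQ; apply: obsC; exact: obs_void. Qed.

Lemma measurable_hit B : admissible B -> measurable (hit B).
Proof. by move=> aB; apply: measurableC; exact: measurable_void. Qed.

Lemma hitP B w : hit B w <-> exists2 a, Pi w a & B a.
Proof.
rewrite /hit /void /=; split => [/eqP/set0P[a [? ?]]|[a ? ?]]; first by exists a.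
by apply/eqP/set0P; exists a.
Qed.

Lemma voidP B w : void B w <-> forall a, Pi w a -> ~ B a.
Proof.
split => [h a Xa Ba|h]; last by apply/seteqP; split => // a [/h].
by have : (Pi w `&` B) a by []; rewrite h.
Qed.

Lemma pr_hit B : admissible B -> pr P (hit B) = 1 - pr P (void B).
Proof. by move=> aB; rewrite pr_setC//; exact: measurable_void. Qed.

Lemma pr_hit_le B : admissible B -> pr P (hit B) <= fine (area B).
Proof.
move=> aB; rewrite pr_hit// pr_void//.
have := expR_ge1Dx (- fine (area B)); lra.
Qed.

Lemma pr_hitI Q B E : admissible B -> B `&` Q = set0 -> obs Q E ->
  pr P (hit B `&` E) = pr P (hit B) * pr P E.
Proof.
move=> aB BQ oE; have mE := obs_measurable oE; have mB := measurable_void aB.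
have := pr_split P mE mB; rewrite [E `&` void B]setIC [E `&` ~` _]setIC.
by rewrite (obs_indep aB BQ oE) -/(hit B) pr_hit// mulrBl mul1r => {1}->; rewrite addrC addKr.
Qed.

Definition crowded B : set Om := ~` (void B `|` count_event Pi B 1).

Lemma crowdedP B w a a' : Pi w a -> Pi w a' -> B a -> B a' -> a <> a' -> crowded B w.
Proof.
move=> Xa Xa' Ba Ba' aa' /=; rewrite /crowded /= => -[/voidP/(_ _ Xa)//|].
rewrite /count_event /= => /eq_cardSP [x _].
rewrite II0 card_eq0 => /eqP h; have H z : (Pi w `&` B) z -> z = x.
  by move=> hz; apply: contrapT => zx; have : ((Pi w `&` B) `\ x) z by []; rewrite h.
by apply: aa'; rewrite (H a)// (H a').
Qed.

Lemma measurable_crowded B : admissible B -> measurable (crowded B).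
Proof.
move=> aB; apply/measurableC/measurableU; first exact: measurable_void.
exact: (lp_meas LP).
Qed.

(** With a the area, exp(-a) >= 1 - a gives (1 + a) exp(-a) >= 1 - a^2 for the probability of at
    most one atom. *)
Lemma pr_crowded B : admissible B -> pr P (crowded B) <= fine (area B) ^+ 2.
Proof.
move=> aB; have mV := measurable_void aB; have m1 := lp_meas LP 1 aB.
rewrite pr_setC; last exact: measurableU.
have -> : pr P (void B `|` count_event Pi B 1) = pr P (void B) + pr P (count_event Pi B 1).
  apply: EFin_inj; rewrite EFinD -!prE//; last exact: measurableU.
  apply: measureU => //; apply/seteqP; split => // w [].
  rewrite voidE /count_event /= => h0 h1.
  by have /card_eq_II := card_eq_trans (card_esym h0) h1.
rewrite pr_void// /pr (lp_count LP)//= expr1 divr1.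
set a := fine _; have a0 : 0 <= a by apply: fine_ge0; exact: measure_ge0.
have h := expR_ge1Dx (- a); have : (1 - a) * (1 + a) <= expR (- a) * (1 + a).
  by rewrite ler_wpM2r// addr_ge0.
have -> : (1 - a) * (1 + a) = 1 - a ^+ 2 by ring.
by rewrite mulrDr mulr1; lra.
Qed.

End Observation.

(** * Measurability of record counts *)

Section Cells.
Context {R : realType}.
Implicit Types (a b : R * R) (q : rat) (l : seq (bool * bool * rat)).

(** A countable family separating points: the first boolean selects the coordinate, the second the
    side of the rational threshold. *)
Definition half_plane (h : bool * bool * rat) : set (R * R) :=
  [set a | let z := if h.1.1 then a.1 else a.2 in
    if h.1.2 then z < ratr h.2 else ratr h.2 < z].

Definition cell l : set (R * R) := [set a | forall h, h \in l -> half_plane h a].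

Lemma measurable_fst_itv (i : interval R) : measurable [set a : R * R | a.1 \in i].
Proof.
rewrite -[X in measurable X]setTI; exact: (measurable_fst measurableT _ (measurable_itv i)).
Qed.

Lemma measurable_snd_itv (i : interval R) : measurable [set a : R * R | a.2 \in i].
Proof.
rewrite -[X in measurable X]setTI; exact: (measurable_snd measurableT _ (measurable_itv i)).
Qed.

Lemma measurable_half_plane h : measurable (half_plane h).
Proof.
case: h => -[[] []] q; rewrite /half_plane /=.
- rewrite (_ : mkset _ = [set a | a.1 \in `]-oo, ratr q[]); first exact: measurable_fst_itv.
  by apply/seteqP; split => a /=; rewrite in_itv.
- rewrite (_ : mkset _ = [set a | a.1 \in `]ratr q, +oo[]); first exact: measurable_fst_itv.
  by apply/seteqP; split => a /=; rewrite in_itv /= andbT.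
- rewrite (_ : mkset _ = [set a | a.2 \in `]-oo, ratr q[]); first exact: measurable_snd_itv.
  by apply/seteqP; split => a /=; rewrite in_itv.
- rewrite (_ : mkset _ = [set a | a.2 \in `]ratr q, +oo[]); first exact: measurable_snd_itv.
  by apply/seteqP; split => a /=; rewrite in_itv /= andbT.
Qed.

Lemma cell_cons h l : cell (h :: l) = half_plane h `&` cell l.
Proof.
apply/seteqP; split => a /=.
  by move=> H; split => [|k kl]; apply: H; rewrite inE ?eqxx// kl orbT.
by move=> [H1 H2] k; rewrite inE => /orP[/eqP ->//|/H2].
Qed.

Lemma measurable_cell l : measurable (cell l).
Proof.
elim: l => [|h l IH]; last first.
  by rewrite cell_cons; apply: measurableI => //; exact: measurable_half_plane.
rewrite (_ : cell [::] = setT); first exact: measurableT.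
by apply/seteqP; split => // a _ h; rewrite in_nil.
Qed.

Lemma half_plane_sep a b : a <> b -> exists2 h, half_plane h a & ~ half_plane h b.
Proof.
have sep (x z : R) : x != z -> exists2 k : bool * rat,
    (if k.1 then x < ratr k.2 else ratr k.2 < x) &
    ~~ (if k.1 then z < ratr k.2 else ratr k.2 < z).
  rewrite neq_lt => /orP[xz|zx].
    have [q] := rat_in_itvoo xz; rewrite in_itv /= => /andP[xq qz].
    by exists (true, q) => //=; rewrite -leNgt ltW.
  have [q] := rat_in_itvoo zx; rewrite in_itv /= => /andP[zq qx].
  by exists (false, q) => //=; rewrite -leNgt ltW.
move=> /eqP; case: a b => [a1 a2] [b1 b2]; rewrite xpair_eqE negb_and => /orP[|] /sep[[k q]].
  by move=> h1 /negP h2; exists (true, k, q).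
by move=> h1 /negP h2; exists (false, k, q).
Qed.

Lemma cell_isolate a (s : seq (R * R)) :
  exists2 l, cell l a & forall b, b \in s -> b <> a -> ~ cell l b.
Proof.
elim: s => [|c s [l la ls]]; first by exists [::].
have [->|/eqP ca] := eqVneq c a.
  by exists l => // b; rewrite inE => /orP[/eqP -> //|/ls].
have [h ha hc] := half_plane_sep (not_eq_sym ca).
exists (h :: l) => [|b]; first by rewrite cell_cons.
rewrite cell_cons inE => /orP[/eqP -> _ [/hc]//|bs ba [_]]; exact: ls.
Qed.

End Cells.

(** * Cardinalities from hitting events *)

Section CardMeasurable.
Context {R : realType} {d : measure_display} {Om : measurableType d}.
Variables (P : probability Om R) (Pi : Om -> set (R * R)) (beta : Om -> R).
Variable Q : set (R * R).
Local Notation ob := (obs Pi beta Q).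

(** Induction on n: there are n + 1 points when some cell catches exactly one of them and n remain
    outside. Cells are countably many, and an isolating one exists because the other points are
    finite in number. *)
Lemma obs_card (S : Om -> set (R * R)) n :
  (forall C, measurable C -> ob [set w | exists2 a, S w a & C a]) ->
  ob [set w | S w #= `I_n].
Proof.
move=> hS; pose H C := [set w | exists2 a, S w a & C a].
suff : forall C, measurable C -> ob [set w | (S w `&` C) #= `I_n].
  move=> /(_ setT measurableT); congr (ob _).
  by apply/seteqP; split => w /=; rewrite setIT.
elim: n => [|n IH] C mC.
  rewrite (_ : mkset _ = ~` H C); first by apply: obsC; exact: hS.
  apply/seteqP; split => w /=; rewrite II0 card_eq0.
    by move=> /eqP h [a Sa Ca]; have : (S w `&` C) a by []; rewrite h.
  by move=> h; apply/eqP/seteqP; split => // a [Sa Ca]; apply: h; exists a.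
(* A point is alone in [cell l] when no [cell l'] splits the points there; this too is a condition
   on hitting events. *)
rewrite (_ : mkset _ = \bigcup_(l : seq (bool * bool * rat))
  (H (C `&` cell l) `&` (\bigcap_(l' : seq (bool * bool * rat))
    ~` (H (C `&` cell l `&` cell l') `&` H ((C `&` cell l) `\` cell l')))
   `&` [set w | (S w `&` (C `\` cell l)) #= `I_n])); last first.
  apply/seteqP; split => w /=.
  - move=> /eq_cardSP[x [Sx Cx]] hn.
    have fin : finite_set ((S w `&` C) `\ x) by exists n.
    have /finite_seqP[s sE] := fin.
    have [l lx ls] := cell_isolate x s.
    have out a : S w a -> C a -> cell l a -> a = x.
      move=> Sa Ca la; apply: contrapT => ax; apply: (ls a) => //.
      by have : [set` s] a by rewrite -sE.
    exists l => //; split; first split.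
    + by exists x.
    + move=> l' _ [[a Sa [[Ca la] al']] [b Sb [[Cb lb] bl']]].
      by apply: bl'; rewrite (out b)// -(out a).
    + rewrite /= (_ : S w `&` (C `\` cell l) = (S w `&` C) `\ x)//.
      apply/seteqP; split => a /=.
        by move=> [Sa [Ca la]]; split => // ax; apply: la; rewrite ax.
      by move=> [[Sa Ca] ax]; split => //; split => // la; apply: ax; exact: out.
  - move=> [l _ [[[x Sx [Cx lx]] sing] hn]]; apply/eq_cardSP; exists x => //.
    have out a : S w a -> C a -> cell l a -> a = x.
      move=> Sa Ca la; apply: contrapT => ax.
      have [h ha hx] := half_plane_sep ax.
      have ca : cell [:: h] a by rewrite cell_cons; split.
      have cx : ~ cell [:: h] x by rewrite cell_cons => -[].
      by apply: (sing [:: h] I); split; [exists a|exists x].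
    move: hn; rewrite /= (_ : S w `&` (C `\` cell l) = (S w `&` C) `\ x)//.
    apply/seteqP; split => a /=.
      by move=> [Sa [Ca la]]; split => // ax; apply: la; rewrite ax.
    by move=> [[Sa Ca] ax]; split => //; split => // la; apply: ax; exact: out.
apply: obs_bigcup => l; have ml := @measurable_cell R l.
have mCl : measurable (C `&` cell l) by exact: measurableI.
have mD : measurable (C `\` cell l) by exact: measurableD.
apply: obsI; last exact: IH mD.
apply: obsI; first exact: hS.
apply: obs_bigcap => l'; have ml' := @measurable_cell R l'.
by apply: obsC; apply: obsI; apply: hS; [exact: measurableI|exact: measurableD].
Qed.

End CardMeasurable.

(** * Record sets from void events *)

Section RecordMeasurable.
Context {R : realType} {d : measure_display} {Om : measurableType d}.
Variables (P : probability Om R) (Pi : Om -> set (R * R)) (beta : Om -> R).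
Variable F : R -> R.
Hypothesis LP : line_process P Pi beta F.
Variable Q : set (R * R).
Hypotheses (mQ : measurable Q) (sQ : Q `<=` strip).
Local Notation ob := (obs Pi beta Q).

Lemma admissible_bounded (B : set (R * R)) (M : R) : measurable B -> B `<=` strip ->
  (forall a, B a -> - M <= a.2) -> admissible B.
Proof.
move=> mB sB hM; split => //; split => //.
apply: (@le_lt_trans _ _ (area (`[0, 1]%classic `*` `[- M, 0]%classic))).
  apply: le_measure; rewrite ?inE//; first exact: measurableX.
  move=> a Ba; have [h1 h2] := sB a Ba; split => /=; rewrite in_itv //=.
  by rewrite hM.
rewrite /area product_measure1E; [|exact: measurable_itv|exact: measurable_itv].
rewrite /= !lebesgue_measure_itv /= !lte_fin.
by case: ifP => _; case: ifP => _; rewrite ?mule0 ?mul0e// -?EFinB -?EFinM ltry.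
Qed.

(** Quadrants at rational corners reduce the comparison of two atoms to countably many tests. *)
Definition nw (r : rat * rat) : set (R * R) := [set b | b.1 < ratr r.1 /\ ratr r.2 < b.2].
Definition se (r : rat * rat) : set (R * R) := [set a | ratr r.1 < a.1 /\ a.2 < ratr r.2].

Lemma nwE r : nw r = [set a | a.1 \in `]-oo, ratr r.1[] `&` [set a | a.2 \in `]ratr r.2, +oo[].
Proof. by apply/seteqP; split => a /=; rewrite !in_itv /= andbT => -[]. Qed.

Lemma seE r : se r = [set a | a.1 \in `]ratr r.1, +oo[] `&` [set a | a.2 \in `]-oo, ratr r.2[].
Proof. by apply/seteqP; split => a /=; rewrite !in_itv /= andbT => -[]. Qed.

Lemma measurable_nw r : measurable (nw r).
Proof.
by rewrite nwE; apply: measurableI; [exact: measurable_fst_itv|exact: measurable_snd_itv].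
Qed.

Lemma measurable_se r : measurable (se r).
Proof.
by rewrite seE; apply: measurableI; [exact: measurable_fst_itv|exact: measurable_snd_itv].
Qed.

Lemma north_west_rat (b a : R * R) : north_west b a <-> exists2 r, nw r b & se r a.
Proof.
split => [[h1 h2]|[r [h1 h2] [h3 h4]]]; last by split; [exact: lt_trans h3|exact: lt_trans h2].
have [q1] := rat_in_itvoo h1; rewrite in_itv /= => /andP[? ?].
have [q2] := rat_in_itvoo h2; rewrite in_itv /= => /andP[? ?].
by exists (q1, q2).
Qed.

(** Some atom passes the finitely many tests in [l]. A finite list allows an induction, and a record
    passes every list. *)
Definition survives (l : seq (rat * rat)) (C : set (R * R)) : set Om :=
  [set w | exists2 a, Pi w a /\ (Q `&` C) a &
    forall r, r \in l -> hit Pi (Q `&` nw r) w -> ~ se r a].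

(** One test at a time: if [nw r] has no atom of [Q] the test says nothing, otherwise it removes
    [se r] from C. *)
Lemma obs_survives l (C : set (R * R)) M : measurable C ->
  (forall a, C a -> - M <= a.2) -> ob (survives l C).
Proof.
elim: l C => [|r l IH] C mC hM.
  rewrite (_ : survives _ _ = hit Pi (Q `&` C)).
    apply: obs_hit => //.
    apply: (@admissible_bounded _ M); first exact: measurableI.
      by move=> a [/sQ].
    by move=> a [_ /hM].
  apply/seteqP; split => w.
    by move=> [a [? ?] _]; apply/hitP; exists a.
  by move=> /hitP[a ? ?]; exists a.
have an : admissible (Q `&` nw r).
  apply: (@admissible_bounded _ (- ratr r.2)).
  - by apply: measurableI => //; exact: measurable_nw.
  - by move=> a [/sQ].
  - by move=> a [_ [_ /ltW]]; rewrite opprK.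
rewrite (_ : survives _ _ = (void Pi (Q `&` nw r) `&` survives l C) `|`
  (hit Pi (Q `&` nw r) `&` survives l (C `\` se r))).
  apply: obsU; apply: obsI.
  - by apply: obs_void => // a [].
  - exact: IH.
  - by apply: obs_hit => // a [].
  - by apply: IH => [|a [/hM]//]; apply: measurableD => //; exact: measurable_se.
apply/seteqP; split => w.
  move=> [a [Xa [Qa Ca]] h]; have [v|v] := pselect (void Pi (Q `&` nw r) w); [left|right].
    by split => //; exists a => // k kl; apply: h; rewrite inE kl orbT.
  split => //; exists a; last by move=> k kl; apply: h; rewrite inE kl orbT.
  by split => //; split => //; split => // sa; apply: (h r) => //; rewrite inE eqxx.
move=> [[v [a [Xa QCa] h]]|[v [a [Xa [Qa [Ca nse]]] h]]].
  by exists a => // k; rewrite inE => /orP[/eqP -> /(_ v)//|/h].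
by exists a => // k; rewrite inE => /orP[/eqP -> //|/h].
Qed.

(** If C contains no record, each of the finitely many atoms there fails some test, and one list
    gathers these tests. So surviving every finite list amounts to the presence of a record; the
    depth bound provides the finiteness. *)
Lemma obs_record_bounded (C : set (R * R)) (n : nat) : measurable C ->
  (forall a, C a -> - n%:R <= a.2) ->
  ob [set w | exists2 a, is_record (Pi w `&` Q) a & C a].
Proof.
move=> mC hC.
rewrite (_ : mkset _ = \bigcap_(l : seq (rat * rat)) survives l C); last first.
  apply/seteqP; split => w /=.
    move=> [a [[Xa Qa] nrec] Ca] l _; exists a => // r rl /hitP[b Xb [Qb nb]] sa.
    apply: nrec; exists b; split => //; split; last by apply/north_west_rat; exists r.
    move=> ba; have [h _] : north_west b a by apply/north_west_rat; exists r.
    by move: h; rewrite ba ltxx.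
  move=> h; apply: contrapT => nrec.
  have fin : finite_set (Pi w `&` (Q `&` C)).
    by apply: (sub_finite_set _ (lp_fin LP w n)) => a [Xa [_ /hC]].
  have /finite_seqP[s sE] := fin.
  have bad a : a \in s -> exists2 r, hit Pi (Q `&` nw r) w & se r a.
    move=> sa; have [Xa [Qa Ca]] : (Pi w `&` (Q `&` C)) a by rewrite sE.
    apply: contrapT => hr; apply: nrec; exists a => //; split => //.
    move=> [b [[Xb Qb] [_ /north_west_rat[r rb ra]]]]; apply: hr; exists r => //.
    by apply/hitP; exists b.
  have [l hl] : exists l : seq (rat * rat), forall a, a \in s ->
      exists2 r, r \in l & hit Pi (Q `&` nw r) w /\ se r a.
    elim: (s) bad => [|c t IH] bad; first by exists [::].
    have [|l hl] := IH.
      by move=> a ta; apply: bad; rewrite inE ta orbT.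
    have [r r1 r2] := bad c (mem_head _ _).
    exists (r :: l) => a; rewrite inE => /orP[/eqP ->|/hl[k kl hk]].
      by exists r => //; rewrite mem_head.
    by exists k => //; rewrite inE kl orbT.
  have [a [Xa QCa] ha] := h l I.
  have /hl[r rl [r1 r2]] : a \in s by have : [set` s] a by rewrite -sE.
  exact: ha r rl r1 r2.
by apply: obs_bigcap => l; exact: obs_survives hC.
Qed.

(** A rational between [a.1] and the line detaches the condition on the line, and an integer bounds
    the depth. *)
Lemma obs_record_hit (C : set (R * R)) : measurable C ->
  ob [set w | exists2 a, is_record (Pi w `&` Q) a /\ a.1 < beta w & C a].
Proof.
move=> mC.
rewrite (_ : mkset _ = \bigcup_(nq : nat * rat)
   (beta @^-1` `]ratr nq.2, +oo[%classic `&`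
    [set w | exists2 a, is_record (Pi w `&` Q) a &
      (C `&` [set a | a.1 \in `]-oo, ratr nq.2[]
         `&` [set a | a.2 \in `[- nq.1%:R, +oo[]) a])).
  apply: obs_bigcup => -[n q] /=; apply: obsI; first by apply: obs_beta; exact: measurable_itv.
  apply: (@obs_record_bounded _ n).
    apply: measurableI; last exact: measurable_snd_itv.
    by apply: measurableI => //; exact: measurable_fst_itv.
  by move=> a [_]; rewrite /= in_itv /= andbT.
apply/seteqP; split => w /=.
  move=> [a [ra ab] Ca]; have [q] := rat_in_itvoo ab; rewrite in_itv /= => /andP[aq qb].
  have [n hn] : exists n : nat, - a.2 < n%:R.
    by exists (Num.Def.archi_bound (- a.2)); apply: archi_boundP; have [[/(lp_strip LP)[_ ?] _] _] := ra; rewrite oppr_ge0.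
  exists (n, q) => //=; split; first by rewrite in_itv /= qb.
  exists a => //; split; first by split => //=; rewrite in_itv.
  by rewrite /= in_itv /= andbT lerNl ltW.
move=> [[n q] _ /= []]; rewrite in_itv /= andbT => qb [a ra [[Ca]]].
by rewrite /= !in_itv /= => aq _; exists a => //; split => //; exact: lt_trans qb.
Qed.

(** Records of the process restricted to [Q]: atoms outside [Q] cannot beat them, so that their
    count is observable from [Q]. *)
Definition rec_set (G : set (R * R)) (w : Om) : set (R * R) :=
  [set a | is_record (Pi w `&` Q) a /\ a.1 < beta w /\ G a].

Lemma obs_rec_card (G : set (R * R)) n : measurable G -> ob [set w | rec_set G w #= `I_n].
Proof.
move=> mG; apply: obs_card => C mC.
rewrite (_ : mkset _ =
  [set w | exists2 a, is_record (Pi w `&` Q) a /\ a.1 < beta w & (G `&` C) a]).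
  by apply: obs_record_hit; exact: measurableI.
by apply/seteqP; split => w /= [a]; [move=> [r [b g]] c|move=> [r b] [g c]]; exists a.
Qed.

End RecordMeasurable.

(** * Records of a rectangle *)

Section CardSucc.
Context {T : Type}.
Implicit Types (A : set T) (x : T).

Lemma card_D1 A x n : A x -> A #= `I_n.+1 -> A `\ x #= `I_n.
Proof.
move=> Ax hA; have fA : finite_set A by exists n.+1.
have [m hm] : finite_set (A `\ x) by exact: finite_setD.
have /card_esym h : A #= `I_m.+1 by apply/eq_cardSP; exists x.
by have /card_eq_II[<-] := card_eq_trans h hA.
Qed.

Lemma card_U1 A x n : ~ A x -> ([set x] `|` A) #= `I_n.+1 <-> A #= `I_n.
Proof.
move=> nA; have e : ([set x] `|` A) `\ x = A.
  apply/seteqP; split => z /=; first by move=> [[->|]].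
  by move=> Az; split; [right|move=> zx; apply: nA; rewrite -zx].
split => [|h]; first by move=> /(card_D1 (or_introl erefl)); rewrite e.
by apply/eq_cardSP; exists x; [left|rewrite e].
Qed.

Lemma card_I0 A : A #= `I_0 <-> A = set0.
Proof. by rewrite II0 card_eq0; split => /eqP. Qed.

Lemma card_I0N A x : A x -> ~ (A #= `I_0).
Proof. by move=> Ax /card_I0 A0; move: Ax; rewrite A0. Qed.

Lemma card_set0S n : ~ ((set0 : set T) #= `I_n.+1).
Proof. by move=> /eq_cardSP[]. Qed.

End CardSucc.

Section Boxes.
Context {R : realType}.
Implicit Types (a b c d x T t : R) (i : interval R) (X Q G : set (R * R)).

(* Points with abscissa in [i] and depth [- a.2] in [[t0, t1[]. *)
Definition bx i (t0 t1 : R) : set (R * R) := [set` i] `*` `]- t1, - t0]%classic.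

Lemma measurable_bx i t0 t1 : measurable (bx i t0 t1).
Proof. by apply: measurableX; exact: measurable_itv. Qed.

Lemma bx_oP c d t0 t1 (a : R * R) :
  bx `[c, d[ t0 t1 a <-> [/\ c <= a.1, a.1 < d, - t1 < a.2 & a.2 <= - t0].
Proof.
rewrite /bx /= !in_itv /=; split => [[/andP[? ?] /andP[? ?]]|[? ? ? ?]] //.
by split; apply/andP.
Qed.

Lemma bx_cP c t0 t1 (a : R * R) :
  bx `[c, 1] t0 t1 a <-> [/\ c <= a.1, a.1 <= 1, - t1 < a.2 & a.2 <= - t0].
Proof.
rewrite /bx /= !in_itv /=; split => [[/andP[? ?] /andP[? ?]]|[? ? ? ?]] //.
by split; apply/andP.
Qed.

Lemma area_bx_o c d t0 t1 : c <= d -> t0 <= t1 ->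
  area (bx `[c, d[ t0 t1) = ((d - c) * (t1 - t0))%:E.
Proof.
move=> cd t01; rewrite /area product_measure1E; [|exact: measurable_itv|exact: measurable_itv].
rewrite /= !lebesgue_measure_itv /= !lte_fin ltrN2.
move: cd t01; rewrite !le_eqVlt => /predU1P[->|->] /predU1P[->|->];
  rewrite ?ltxx ?subrr ?mulr0 ?mul0r ?mule0 ?mul0e//.
by rewrite -!EFinB -EFinM opprK [- t0 + _]addrC.
Qed.

Lemma area_bx_c c t0 t1 : c <= 1 -> t0 <= t1 ->
  area (bx `[c, 1] t0 t1) = ((1 - c) * (t1 - t0))%:E.
Proof.
move=> cd t01; rewrite /area product_measure1E; [|exact: measurable_itv|exact: measurable_itv].
rewrite /= !lebesgue_measure_itv /= !lte_fin ltrN2.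
move: cd t01; rewrite !le_eqVlt => /predU1P[->|->] /predU1P[->|->];
  rewrite ?ltxx ?subrr ?mulr0 ?mul0r ?mule0 ?mul0e//.
by rewrite -!EFinB -EFinM opprK [- t0 + _]addrC.
Qed.

Lemma bx_strip_o c d t0 t1 : 0 <= c -> d <= 1 -> 0 <= t0 -> bx `[c, d[ t0 t1 `<=` strip.
Proof.
by move=> c0 d1 t00 a /bx_oP[? ? ? ?]; split; [apply/andP; split|]; lra.
Qed.

Lemma bx_strip_c c t0 t1 : 0 <= c -> 0 <= t0 -> bx `[c, 1] t0 t1 `<=` strip.
Proof. by move=> c0 t00 a /bx_cP[? ? ? ?]; split; [apply/andP; split|]; lra. Qed.

Lemma admissible_bx_o c d t0 t1 : 0 <= c -> c <= d -> d <= 1 -> 0 <= t0 -> t0 <= t1 ->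
  admissible (bx `[c, d[ t0 t1).
Proof.
move=> c0 cd d1 t00 t01; split; first exact: measurable_bx.
by split; [exact: bx_strip_o|rewrite area_bx_o// ltry].
Qed.

Lemma admissible_bx_c c t0 t1 : 0 <= c -> c <= 1 -> 0 <= t0 -> t0 <= t1 ->
  admissible (bx `[c, 1] t0 t1).
Proof.
move=> c0 c1 t00 t01; split; first exact: measurable_bx.
by split; [exact: bx_strip_c|rewrite area_bx_c// ltry].
Qed.

Lemma is_record_ext X Q Q' (a : R * R) : (Q a <-> Q' a) ->
  (forall b : R * R, X b -> north_west b a -> Q b <-> Q' b) ->
  is_record (X `&` Q) a <-> is_record (X `&` Q') a.
Proof.
move=> h H; split => -[[Xa Qa] nr]; split.
- by split => //; apply/h.
- by move=> [b [[Xb Qb] [ba nb]]]; apply: nr; exists b; split; [split => //; apply/H|].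
- by split => //; apply/h.
- by move=> [b [[Xb Qb] [ba nb]]]; apply: nr; exists b; split; [split => //; apply/H|].
Qed.

End Boxes.

(** * How records change with the rectangle *)

Section RectangleRecords.
Context {R : realType} {d0 : measure_display} {Om : measurableType d0}.
Variables (P : probability Om R) (Pi : Om -> set (R * R)) (beta : Om -> R).
Variable F : R -> R.
Hypothesis LP : line_process P Pi beta F.
Implicit Types (c d x T u : R) (j n : nat) (w : Om).

Definition rbox x T := bx `[x, 1] 0 T.
Definition recs x T := rec_set Pi beta (rbox x T) setT.
Definition cnt x T j : set Om := [set w | recs x T w #= `I_j].
Definition col c d T := bx `[c, d[ 0 T.

Lemma recs_eq x T x' T' w :
  (forall a, Pi w a -> a.1 < beta w -> is_record (Pi w `&` rbox x T) a <->
    is_record (Pi w `&` rbox x' T') a) -> recs x T w = recs x' T' w.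
Proof.
move=> h; apply/seteqP; split => a [ra [ab _]]; split => //.
  by apply/h => //; case: ra => -[].
by apply/h => //; case: ra => -[].
Qed.

Lemma in_rbox x T w a : Pi w a -> x <= a.1 -> - T < a.2 -> rbox x T a.
Proof.
by move=> /(lp_strip LP)[/andP[_ ?] ?] ? ?; apply/bx_cP; rewrite oppr0.
Qed.

Lemma recs_void_col c d T w : c <= d -> void Pi (col c d T) w ->
  recs c T w = recs d T w.
Proof.
move=> cd /voidP v.
have H a : Pi w a -> rbox c T a <-> rbox d T a.
  move=> Xa; split => /bx_cP[h1 h2 h3 h4]; apply/bx_cP; split => //; last by lra.
  rewrite leNgt; apply/negP => ad; apply: (v a Xa); exact/bx_oP.
by apply: recs_eq => a Xa _; apply: is_record_ext => [|b Xb _]; exact: H.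
Qed.

(** An atom of the column above depth T beats every deeper atom right of d, and the deeper part of
    the column is void. *)
Lemma recs_deeper c d T T' w : c <= d -> T <= T' -> hit Pi (col c d T) w ->
  void Pi (bx `[c, d[ T T') w -> recs c T' w = recs c T w.
Proof.
move=> cd TT' /hitP[a1 X1 /bx_oP[h1 h2 h3 h4]] /voidP v.
apply: recs_eq => a Xa _; split => -[[_ Qa] nr].
  have aT : - T < a.2.
    rewrite ltNge; apply/negP => aT; have [k1 k2 k3 k4] := (bx_cP _ _ _ _).1 Qa.
    have [ad|da] := ltP a.1 d; first by apply: (v a Xa); exact/bx_oP.
    apply: nr; exists a1; split.
      by split => //; apply: (in_rbox X1) => //; lra.
    have nw1 : north_west a1 a by split; lra.
    by split => // e; move: nw1; rewrite e => -[]; rewrite ltxx.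
  have [k1 k2 k3 k4] := (bx_cP _ _ _ _).1 Qa.
  split; first by split => //; apply: (in_rbox Xa).
  move=> [b [[Xb /bx_cP[l1 l2 l3 l4]] nb]]; apply: nr; exists b; split => //.
  by split => //; apply: (in_rbox Xb) => //; lra.
have [k1 k2 k3 k4] := (bx_cP _ _ _ _).1 Qa.
split; first by split => //; apply: (in_rbox Xa) => //; lra.
move=> [b [[Xb /bx_cP[l1 l2 l3 l4]] [ba nb]]]; apply: nr; exists b; split => //.
by split => //; apply: (in_rbox Xb) => //; case: nb => _ ?; lra.
Qed.

(** [a0] lies left of and below [rbox d T], so it neither beats the atoms there nor is beaten by
    them. *)
Lemma recs_cell c d T T' w a0 : c <= d -> 0 <= T -> T <= T' ->
  void Pi (col c d T) w -> void Pi (bx `[d, 1] T T') w ->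
  Pi w a0 -> bx `[c, d[ T T' a0 ->
  (forall a, Pi w a -> bx `[c, d[ T T' a -> a = a0) ->
  recs c T' w = (if a0.1 < beta w then [set a0] else set0) `|` recs d T w.
Proof.
move=> cd T0 TT' /voidP vcol /voidP vrow X0 B0 uniq.
have [h1 h2 h3 h4] := (bx_oP _ _ _ _ _).1 B0.
have region a : Pi w a -> rbox c T' a -> a = a0 \/ rbox d T a.
  move=> Xa /bx_cP[k1 k2 k3 k4]; have [ad|da] := ltP a.1 d; have [aT|Ta] := leP a.2 (- T).
  - by left; apply: uniq => //; exact/bx_oP.
  - by exfalso; apply: (vcol a Xa); apply/bx_oP; split => //; lra.
  - by exfalso; apply: (vrow a Xa); exact/bx_cP.
  - by right; exact: in_rbox Xa _ _.
have sub a : rbox d T a -> rbox c T' a.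
  by move=> /bx_cP[k1 k2 k3 k4]; apply/bx_cP; split => //; lra.
have above b : rbox d T b -> - T < b.2 by move=> /bx_cP[].
have right b : rbox d T b -> d <= b.1 by move=> /bx_cP[].
apply/seteqP; split => a.
  move=> [[[Xa Qa] nr] [ab _]]; case: (region a Xa Qa) => [e|Qd].
    by left; rewrite -e ab.
  right; split; last by split.
  split; first by split.
  by move=> [b [[Xb Qb] nb]]; apply: nr; exists b; split => //; split => //; exact: sub.
move=> [|[[[Xa Qa] nr] [ab _]]].
  case: ifP => // ab ->; split; last by split.
  split; first by split => //; apply: (in_rbox X0) => //; lra.
  move=> [b [[Xb Qb] [ba [nb _]]]]; case: (region b Xb Qb) => // /right; lra.
split; last by split.
split; first by split => //; exact: sub.
move=> [b [[Xb Qb] [ba nb]]]; case: (region b Xb Qb) => [e|Qd].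
  by move: nb => [_]; rewrite e; have := above _ Qa; lra.
by apply: nr; exists b.
Qed.

Lemma recs_line x T w : beta w <= x -> recs x T w = set0.
Proof.
move=> bx; apply/seteqP; split => // a [[[_ /bx_cP[xa _ _ _]] _] [ab _]].
by move: (lt_le_trans ab bx); rewrite ltNge xa.
Qed.

Definition step_event j d T : set Om :=
  if j is i.+1 then beta @^-1` `[d, +oo[%classic `&` cnt d T i
  else beta @^-1` `]-oo, d[%classic.

(** If the line is left of c nothing is counted; if it is at or right of d, the new atom is counted
    besides the records of [rbox d T]. *)
Lemma cnt_cell j c d T T' w : c <= d -> 0 <= T -> T <= T' ->
  void Pi (col c d T) w -> void Pi (bx `[d, 1] T T') w ->
  hit Pi (bx `[c, d[ T T') w -> ~ crowded Pi (bx `[c, d[ T T') w ->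
  ~ (beta @^-1` `[c, d[%classic) w ->
  cnt c T' j w <-> step_event j d T w.
Proof.
move=> cd T0 TT' vcol vrow /hitP[a0 X0 B0] ncr nb.
have uniq a : Pi w a -> bx `[c, d[ T T' a -> a = a0.
  by move=> Xa Ba; apply: contrapT => ne; apply: ncr; exact: (crowdedP X0 Xa B0 Ba (not_eq_sym ne)).
rewrite /cnt /= (recs_cell cd T0 TT' vcol vrow X0 B0 uniq).
have [h1 h2 h3 h4] := (bx_oP _ _ _ _ _).1 B0.
have [bd|db] := ltP (beta w) d.
  have bc : beta w < c.
    by rewrite ltNge; apply/negP => cb; apply: nb; rewrite /= in_itv /= cb.
  have -> : (a0.1 < beta w) = false by apply/negbTE; rewrite -leNgt; lra.
  rewrite set0U recs_line; last by lra.
  case: j => [|j] /=; first by rewrite in_itv /= bd; split => // _; exact/card_I0.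
  split; first by move=> /card_set0S.
  by rewrite in_itv /= andbT leNgt bd => -[].
have -> : a0.1 < beta w by lra.
have n0 : ~ recs d T w a0.
  by move=> [[[_ /bx_cP[k1 _ _ _]] _] _]; lra.
case: j => [|j] /=.
  rewrite in_itv /= ltNge db; split => // h.
  by exfalso; apply: (@card_I0N _ ([set a0] `|` recs d T w) a0) => //; left.
rewrite in_itv /= andbT db; split; first by move=> /(card_U1 _ n0).
by move=> [_ h]; exact/(card_U1 _ n0).
Qed.

Lemma obs_cnt x T j : 0 <= x -> obs Pi beta (rbox x T) (cnt x T j).
Proof.
move=> x0; apply: (obs_rec_card LP) => //; first exact: measurable_bx.
exact: bx_strip_c.
Qed.

End RectangleRecords.

(** * Increments of the law in a rectangle *)

Section RectangleLaw.
Context {R : realType} {d0 : measure_display} {Om : measurableType d0}.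
Variables (P : probability Om R) (Pi : Om -> set (R * R)) (beta : Om -> R).
Variable F : R -> R.
Hypothesis LP : line_process P Pi beta F.
Implicit Types (c d x T u : R) (j n : nat) (w : Om).
Local Notation pr := (pr P).
Local Notation hit := (hit Pi).
Local Notation void := (void Pi).
Local Notation cnt := (cnt Pi beta).

Definition law j x T : R := pr (cnt x T j).

Lemma measurable_cnt x T j : 0 <= x -> measurable (cnt x T j).
Proof. by move=> x0; apply: (obs_measurable LP); exact: (obs_cnt LP). Qed.

Lemma pr_set0 : pr set0 = 0.
Proof. by rewrite /pr measure0. Qed.

Lemma pr_beta_lt x : 0 <= x <= 1 -> pr (beta @^-1` `]-oo, x[%classic) = F x.
Proof. by move=> x01; rewrite /pr (lp_F LP). Qed.

Lemma pr_void_bx c d t0 t1 : 0 <= c -> c <= d -> d <= 1 -> 0 <= t0 -> t0 <= t1 ->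
  pr (void (bx `[c, d[ t0 t1)) = expR (- ((d - c) * (t1 - t0))).
Proof.
move=> c0 cd d1 t00 t01; rewrite (pr_void LP) ?area_bx_o//.
exact: admissible_bx_o.
Qed.

Lemma bx_disj_x c d e t0 t1 t2 t3 : d <= e ->
  bx `[c, d[ t0 t1 `&` bx `[e, 1] t2 t3 = set0 :> set (R * R).
Proof.
move=> de; apply/seteqP; split => // a [/bx_oP[? ? ? ?] /bx_cP[? ? ? ?]].
by exfalso; lra.
Qed.

Lemma bx_disj_t (i i' : interval R) t0 t1 t2 t3 : t1 <= t2 ->
  bx i t0 t1 `&` bx i' t2 t3 = set0 :> set (R * R).
Proof.
move=> de; apply/seteqP; split => // a [[_ h1] [_ h2]]; move: h1 h2; rewrite /= !in_itv /=.
by move=> /andP[? ?] /andP[? ?]; exfalso; lra.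
Qed.

Lemma obs_step_event j d T : 0 <= d -> obs Pi beta (rbox d T) (step_event Pi beta j d T).
Proof.
move=> dp; case: j => [|j]; first by apply: obs_beta; exact: measurable_itv.
by apply: obsI; [apply: obs_beta; exact: measurable_itv|exact: (obs_cnt LP)].
Qed.

(** Requiring the line at or right of d removes from [law i] the configurations with the line left
    of d; there nothing is counted, so the loss is F d for i = 0 and 0 otherwise. *)
Lemma pr_step_event j d T : 0 <= d <= 1 ->
  pr (step_event Pi beta j d T) = step_law F law j d T.
Proof.
move=> d01; case: j => [|j]; first exact: pr_beta_lt.
have mc : measurable (cnt d T j) by apply: measurable_cnt; case/andP: d01.
have mb : measurable (beta @^-1` `]-oo, d[%classic).
  by apply: (measurable_beta LP); exact: measurable_itv.
have := pr_split P mc mb; rewrite /= -/(law j d T) => ->.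
have -> : ~` (beta @^-1` `]-oo, d[%classic) = beta @^-1` `[d, +oo[%classic.
  by apply/seteqP; split => w /=; rewrite !in_itv /= andbT leNgt => /negP.
rewrite [X in pr X = _]setIC [X in _ = X + _ - _](_ : _ = F d * (j == 0%N)%:R).
  by rewrite addrAC subrr add0r.
have bd w : (beta @^-1` `]-oo, d[%classic) w -> recs Pi beta d T w = set0.
  by rewrite /= in_itv /= => h; apply: recs_line; exact: ltW.
case: j {mc} => [|j] /=.
  rewrite mulr1 -pr_beta_lt//; congr (pr _).
  apply/seteqP; split => w; first by case.
  by move=> h; split => //; rewrite /cnt /= bd//; exact/card_I0.
rewrite mulr0 -pr_set0; congr (pr _); apply/seteqP; split => // w [h1 h2].
by move: h1; rewrite /cnt /= bd// => /card_set0S.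
Qed.

(* Its growth in [T] is governed by the arrival of a single atom in the column. *)
Definition psi j c d T : R := pr (hit (col c d T) `&` cnt c T j).

(** When the column is void the records are those of [rbox d T], whose count is independent of the
    column. *)
Lemma psiE j c d T : 0 <= c -> c <= d -> d <= 1 -> 0 <= T ->
  psi j c d T = law j c T - expR (- ((d - c) * T)) * law j d T.
Proof.
move=> c0 cd d1 T0; have dp := le_trans c0 cd.
have aC : admissible (col c d T) by exact: admissible_bx_o.
have := pr_split P (measurable_cnt T j c0) (measurable_void LP aC).
rewrite -/(law j c T) => ->.
have -> : cnt c T j `&` void (col c d T) = void (col c d T) `&` cnt d T j.
  rewrite setIC; apply/seteqP; split => w [v]; rewrite /cnt /=.
    by rewrite (recs_void_col beta cd v).
  by rewrite -(recs_void_col beta cd v).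
rewrite (obs_indep LP aC (bx_disj_x _ _ _ _ _ (lexx d)) (obs_cnt LP _ dp)).
rewrite pr_void_bx// subr0 -/(law j d T) /psi setIC; ring.
Qed.

Lemma psi_zero j c d : psi j c d 0 = 0.
Proof.
rewrite /psi (_ : _ `&` _ = set0) ?pr_set0//; apply/seteqP; split => // w [/hitP[a _]].
by move=> /bx_oP[_ _ h1 h2]; exfalso; lra.
Qed.

Lemma psi_ge0 j c d T : 0 <= psi j c d T.
Proof. exact: pr_ge0. Qed.

Lemma psi_le j c d T : 0 <= c -> c <= d -> d <= 1 -> 0 <= T -> psi j c d T <= (d - c) * T.
Proof.
move=> c0 cd d1 T0.
have aC : admissible (col c d T) by exact: admissible_bx_o.
apply: (@le_trans _ _ (pr (hit (col c d T)))).
  apply: pr_le; last by move=> w [].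
    by apply: measurableI; [exact: (measurable_hit LP)|exact: measurable_cnt].
  exact: (measurable_hit LP).
by have := pr_hit_le LP aC; rewrite area_bx_o//= subr0.
Qed.

(** A greater depth matters only through the cell below the column: if the cell is void, a hit
    column hides all that is new; if it holds one atom, [step_event] decides. *)
Lemma psi_increment j c d T T' : 0 <= c -> c <= d -> d <= 1 -> 0 <= T -> T <= T' ->
  `|psi j c d T' - (psi j c d T + expR (- ((d - c) * T)) *
      (1 - expR (- ((d - c) * (T' - T)))) * step_law F law j d T)| <=
  2 * ((d - c) * (T' - T) * ((d - c) * T + (T' - T) + (d - c) * (T' - T) + (d - c))).
Proof.
move=> c0 cd d1 T0 TT'; have dp := le_trans c0 cd; have T'0 := le_trans T0 TT'.
have c1 := le_trans cd d1.
pose cell := bx `[c, d[ T T'; pose row := bx `[d, 1] T T'.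
(* A hit cell together with a hit column, a hit row to the right, a second atom, or the line in [c,
   d[. Only the row term lacks the factor (d-c)^2, and it is quadratic in T' - T. *)
pose B := hit cell `&` hit (col c d T) `|` hit cell `&` hit row `|`
  crowded Pi cell `|` beta @^-1` `[c, d[%classic `&` hit cell.
pose V := step_event Pi beta j d T.
have aCol : admissible (col c d T) by exact: admissible_bx_o.
have aCol' : admissible (col c d T') by exact: admissible_bx_o.
have aCell : admissible cell by exact: admissible_bx_o.
have aRow : admissible row by exact: admissible_bx_c.
have mH := measurable_hit LP; have mVd := measurable_void LP.
have mCr := measurable_crowded LP aCell.
have oV : obs Pi beta (rbox d T) V by exact: obs_step_event.
have mV : measurable V by exact: (obs_measurable LP oV).
have mb : measurable (beta @^-1` `[c, d[%classic).
  by apply: (measurable_beta LP); exact: measurable_itv.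
have mB1 : measurable (hit cell `&` hit (col c d T)) by apply: measurableI; exact: mH.
have mB2 : measurable (hit cell `&` hit row) by apply: measurableI; exact: mH.
have mB4 : measurable (beta @^-1` `[c, d[%classic `&` hit cell).
  by apply: measurableI => //; exact: mH.
have mB12 := measurableU _ _ mB1 mB2; have mB123 := measurableU _ _ mB12 mCr.
have mB : measurable B by exact: measurableU.
have len : 0 <= d - c by rewrite subr_ge0.
have eps : 0 <= T' - T by rewrite subr_ge0.
have hC : pr (hit cell) <= (d - c) * (T' - T).
  by have := pr_hit_le LP aCell; rewrite area_bx_o.
have prB : pr B <= (d - c) * (T' - T) * ((d - c) * T + (T' - T) + (d - c) * (T' - T) + (d - c)).
  pose k := (d - c) * (T' - T).
  rewrite [leRHS](_ : _ = k * ((d - c) * T) + k * (T' - T) + k * k + k * (d - c));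
    last by rewrite /k; ring.
  apply: le_trans (pr_setU_le P mB123 mB4) _; apply: lerD.
  apply: le_trans (pr_setU_le P mB12 mCr) _; apply: lerD.
  apply: le_trans (pr_setU_le P mB1 mB2) _; apply: lerD.
  - have o : obs Pi beta (col c d T) (hit (col c d T)) by apply: obs_hit.
    rewrite (pr_hitI LP aCell _ o); last by rewrite setIC; exact: bx_disj_t.
    apply: ler_pM; [exact: pr_ge0|exact: pr_ge0|exact: hC|].
    by have := pr_hit_le LP aCol; rewrite area_bx_o//= subr0.
  - have o : obs Pi beta row (hit row) by apply: obs_hit.
    rewrite (pr_hitI LP aCell _ o); last exact: bx_disj_x.
    apply: ler_pM; [exact: pr_ge0|exact: pr_ge0|exact: hC|].
    have := pr_hit_le LP aRow; rewrite area_bx_c//= => /le_trans; apply.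
    by rewrite ler_piMl// lerBlDr lerDl.
  - by have := pr_crowded LP aCell; rewrite area_bx_o//= expr2.
  - have o : obs Pi beta set0 (beta @^-1` `[c, d[%classic).
      by apply: obs_beta; exact: measurable_itv.
    rewrite setIC (pr_hitI LP aCell _ o); last by rewrite setI0.
    apply: ler_pM; [exact: pr_ge0|exact: pr_ge0|exact: hC|].
    apply: le_trans (lp_lip LP c0 cd d1).
    have m1 : measurable (beta @^-1` `]-oo, d[%classic).
      by apply: (measurable_beta LP); exact: measurable_itv.
    have m2 : measurable (beta @^-1` `]-oo, c[%classic).
      by apply: (measurable_beta LP); exact: measurable_itv.
    have := pr_split P m1 m2; rewrite pr_beta_lt ?dp// => ->.
    rewrite [X in pr X + _](_ : _ = beta @^-1` `]-oo, c[%classic); last first.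
      apply/seteqP; split => w /=; rewrite !in_itv /=; first by case.
      by move=> bc; split => //; exact: lt_le_trans cd.
    rewrite pr_beta_lt ?c0// addrAC subrr add0r.
    rewrite [X in _ <= pr X](_ : _ = beta @^-1` `[c, d[%classic)//.
    apply/seteqP; split => w /=; rewrite !in_itv /=.
      by move=> [bd /negP]; rewrite -leNgt bd andbT.
    by move=> /andP[cb bd]; split => //; apply/negP; rewrite -leNgt.
have -> : expR (- ((d - c) * T)) * (1 - expR (- ((d - c) * (T' - T)))) * step_law F law j d T
    = pr (void (col c d T) `&` (hit cell `&` V)).
  pose Q := cell `|` rbox d T.
  have o : obs Pi beta Q (hit cell `&` V).
    apply: obsI; first by apply: obs_hit => // a; left.
    by apply: obsS oV => a; right.
  rewrite (obs_indep LP aCol _ o); last first.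
    by rewrite setIUr /cell /rbox bx_disj_x// bx_disj_t// setU0.
  rewrite (pr_hitI LP aCell _ oV); last exact: bx_disj_x.
  rewrite (pr_hit LP aCell) !pr_void_bx// subr0 pr_step_event ?dp// mulrA.
  by [].
apply: le_trans (ler_wpM2l _ prB) => //.
apply: pr_approx => //.
- by apply: measurableI; [exact: mH|exact: measurable_cnt].
- by apply: measurableI; [exact: mH|exact: measurable_cnt].
- by apply: measurableI; [exact: mVd|apply: measurableI => //; exact: mH].
- move=> w nB.
  have nB1 : hit cell w -> void (col c d T) w.
    by move=> hc; apply: contrapT => h; apply: nB; left; left; left.
  have nB2 : hit cell w -> void row w.
    by move=> hc; apply: contrapT => h; apply: nB; left; left; right.
  have nB3 : ~ crowded Pi cell w by move=> h; apply: nB; left; right.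
  have nB4 : hit cell w -> ~ (beta @^-1` `[c, d[%classic) w.
    by move=> hc h; apply: nB; right.
  have colS : hit (col c d T) w -> hit (col c d T') w.
    move=> /hitP[a Xa /bx_oP[? ? ? ?]]; apply/hitP; exists a => //; apply/bx_oP.
    by split => //; lra.
  have cellS : hit cell w -> hit (col c d T') w.
    move=> /hitP[a Xa /bx_oP[? ? ? ?]]; apply/hitP; exists a => //; apply/bx_oP.
    by split => //; lra.
  have [hc|vc] := pselect (hit cell w).
    have key : cnt c T' j w <-> V w.
      exact: (cnt_cell LP _ cd T0 TT' (nB1 hc) (nB2 hc) hc nB3 (nB4 hc)).
    split=> [[_ /key hV]|]; first by right; split; [exact: nB1|split].
    by case=> [[/(_ (nB1 hc))//]|[_ [_ /key hV]]]; split => //; exact: cellS.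
  have vcell : void cell w by exact: contrapT.
  split=> [[hc' hj]|].
    have hcol : hit (col c d T) w.
      move: hc' => /hitP[a Xa /bx_oP[k1 k2 k3 k4]]; apply/hitP; exists a => //.
      apply/bx_oP; split => //; rewrite ltNge; apply/negP => aT.
      by move/voidP : vcell => /(_ a Xa); apply; apply/bx_oP.
    by left; split => //; move: hj; rewrite /cnt /= (recs_deeper LP cd TT').
  case=> [[hcol hj]|[_ [/vc]]] //.
  by split; [exact: colS|move: hj; rewrite /cnt /= (recs_deeper LP cd TT')].
- by move=> w _ [h _] [/h].
Qed.

End RectangleLaw.

(** * Identification of the law in a rectangle *)

Section RectangleLawExplicit.
Context {R : realType} {d0 : measure_display} {Om : measurableType d0}.
Variables (P : probability Om R) (Pi : Om -> set (R * R)) (beta : Om -> R).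
Variable F : R -> R.
Hypothesis LP : line_process P Pi beta F.
Variables C U : nat -> R -> R -> R.
Hypothesis U_tangent : forall j x M, 0 <= x <= 1 -> 0 <= M ->
  tangent 0 M (U j x) (step_law F C j x).
Hypothesis U_zero : forall j x, U j x 0 = 0.
Hypothesis C_tangent : forall j T, 0 <= T ->
  tangent 0 1 (fun x => expR (- (x * T)) * C j x T)
    (fun x => - (expR (- (x * T)) * U j x T)).
Hypothesis C_one : forall j T, C j 1 T = (j == 0%N)%:R.
Implicit Types (c d x T u : R) (j n : nat).
Local Notation law := (law P Pi beta).
Local Notation psi := (psi P Pi beta).

Lemma void_rate (a b v : R) : 0 <= a -> 0 <= b -> 0 <= v <= 1 ->
  `|expR (- a) * (1 - expR (- b)) * v - b * v| <= a * b + b ^+ 2.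
Proof.
move=> a0 b0 /andP[v0 v1].
have /andP[a1 a2] := expRN_bounds a0; have /andP[b1 b2] := expRN_bounds b0.
have ea : expR (- a) <= 1 by rewrite expR_le1 oppr_le0.
have eb : expR (- b) <= 1 by rewrite expR_le1 oppr_le0.
have ea0 := expR_gt0 (- a).
have h1 : 0 <= b - expR (- a) * (1 - expR (- b)) <= a * b + b ^+ 2.
  have : expR (- a) * (1 - expR (- b)) <= 1 * b.
    by apply: ler_pM; [exact: ltW| |exact: ea|]; lra.
  have : (1 - a) * b <= expR (- a) * b by rewrite ler_wpM2r.
  have : expR (- a) * (b - b ^+ 2) <= expR (- a) * (1 - expR (- b)).
    by rewrite ler_wpM2l ?(ltW ea0)//; lra.
  have : expR (- a) * b ^+ 2 <= b ^+ 2 by rewrite ler_piMl ?exprn_ge0.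
  by move=> k1 k2 k3 k4; apply/andP; split; lra.
move: h1 => /andP[h1 h2].
have -> : expR (- a) * (1 - expR (- b)) * v - b * v =
  - ((b - expR (- a) * (1 - expR (- b))) * v) by ring.
by rewrite normrN normrM (ger0_norm v0) (ger0_norm h1); apply: le_trans (ler_piMr h1 v1) h2.
Qed.

(** Integrates [psi_increment] over T in [0, M]. Only errors linear in T' - T survive: (d-c)^2 times
    2 (M + 1) from the exceptional event and M from [void_rate]. *)
Lemma psi_prim j c d M : 0 <= c -> c <= d -> d <= 1 -> 0 <= M ->
  (forall T, 0 <= T -> step_law F law j d T = step_law F C j d T) ->
  `|psi j c d M - (d - c) * U j d M| <= (d - c) ^+ 2 * (3 * M + 2) * M.
Proof.
move=> c0 cd d1 M0 hV; have dp := le_trans c0 cd.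
have d01 : 0 <= d <= 1 by rewrite dp.
have V01 T : 0 <= T -> 0 <= step_law F C j d T <= 1.
  move=> T0; rewrite -hV// -(pr_step_event LP)//.
  rewrite pr_ge0 pr_le1//; exact: (obs_measurable LP (obs_step_event LP _ dp)).
have [K K0 hK] := U_tangent j d01 M0.
pose dl := d - c; have dl0 : 0 <= dl by rewrite subr_ge0.
pose f T := psi j c d T - dl * U j d T.
have -> : psi j c d M - (d - c) * U j d M = f M - f 0.
  by rewrite /f psi_zero U_zero mulr0 subr0 subr0.
rewrite -[X in _ * X]subr0.
apply: (@increment_le _ f 0 M _ (2 * dl + 3 * dl ^+ 2 + dl * K)) => //.
  by rewrite !addr_ge0 ?mulr_ge0// exprn_ge0.
move=> u v u0 uv vM; have uM := le_trans uv vM; have v0 := le_trans u0 uv.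
have ep0 : 0 <= v - u by rewrite subr_ge0.
have h1 := psi_increment LP j c0 cd d1 u0 uv; rewrite hV// -/dl in h1.
have h2 := void_rate (mulr_ge0 dl0 u0) (mulr_ge0 dl0 ep0) (V01 _ u0).
have := hK u v; rewrite u0 uM v0 vM => /(_ isT isT) h3.
have h4 := ler_wpM2l dl0 h3; rewrite -{1}(ger0_norm dl0) -normrM in h4.
set V := step_law F C j d u in h1 h2 h3 h4.
have -> : f v - f u =
  (psi j c d v - (psi j c d u + expR (- (dl * u)) * (1 - expR (- (dl * (v - u)))) * V))
  + (expR (- (dl * u)) * (1 - expR (- (dl * (v - u)))) * V - dl * (v - u) * V)
  - dl * (U j d v - U j d u - (v - u) * V) by rewrite /f; ring.
apply: le_trans (ler_normB _ _) _; apply: le_trans (lerD (ler_normD _ _) h4) _.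
apply: le_trans (lerD (lerD h1 h2) (lexx _)) _.
have hu : dl ^+ 2 * (v - u) * u <= dl ^+ 2 * (v - u) * M.
  by rewrite ler_wpM2l// mulr_ge0// exprn_ge0.
rewrite -subr_ge0 [X in 0 <= X](_ : _ =
  3 * (dl ^+ 2 * (v - u) * M - dl ^+ 2 * (v - u) * u)).
  by rewrite mulr_ge0// subr_ge0.
by rewrite /dl; ring.
Qed.

(** At x = 1 the rectangle is a segment of area zero, hence almost surely void. *)
Lemma law_one j T : 0 <= T -> law j 1 T = (j == 0%N)%:R.
Proof.
move=> T0; have le01 : (0 : R) <= 1 by [].
have aQ : admissible (rbox (1 : R) T) by exact: admissible_bx_c.
have mV := measurable_void LP aQ; have mc := measurable_cnt LP T j le01.
have pH : pr P (hit Pi (rbox 1 T)) = 0.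
  apply/eqP; rewrite eq_le pr_ge0 andbT; have := pr_hit_le LP aQ.
  by rewrite area_bx_c//= subrr mul0r.
have pV : pr P (void Pi (rbox 1 T)) = 1.
  by have := pr_hit LP aQ; rewrite pH; lra.
rewrite /law (pr_split P mc mV).
have -> : pr P (cnt Pi beta 1 T j `&` ~` void Pi (rbox 1 T)) = 0.
  apply/eqP; rewrite eq_le pr_ge0 andbT -pH; apply: pr_le; last by move=> w [].
    by apply: measurableI => //; exact: measurableC.
  exact: measurableC.
have emp w : void Pi (rbox 1 T) w -> recs Pi beta 1 T w = set0.
  by move=> v; apply/seteqP; split => // a [[h _] _]; rewrite -v.
rewrite addr0; case: j {mc} => [|j] /=.
  rewrite -[RHS]pV; congr (pr P _); apply/seteqP; split => [w []//|w].
  by move=> v; split => //; rewrite /cnt /= emp//; exact/card_I0.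
transitivity (pr P set0); last by rewrite pr_set0.
congr (pr P _); apply/seteqP; split => // w [h v].
by move: h; rewrite /cnt /= emp// => /card_set0S.
Qed.

(** Induction on j, since the step for j + 1 involves [law] at j. Then exp(-zT) times the difference
    of the two laws has quadratic increments in z and vanishes at z = 1. *)
Theorem rect_law j x T : 0 <= x <= 1 -> 0 <= T -> law j x T = C j x T.
Proof.
elim/ltn_ind: j x T => j IH x T /andP[x0 x1] T0.
have hV d u : 0 <= d <= 1 -> 0 <= u -> step_law F law j d u = step_law F C j d u.
  by move=> d01 u0; case: j IH => [|j] IH //=; rewrite IH.
have [K K0 hK] := C_tangent j T0.
pose k := (3 * T + 2) * T; have k0 : 0 <= k by rewrite mulr_ge0// addr_ge0// mulr_ge0.
pose g z := expR (- (z * T)) * law j z T - expR (- (z * T)) * C j z T.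
have eq1 : g 1 = g x.
  apply: (@increment_eq _ g x 1 (k + K + (T + k) * T)) => //.
    by rewrite !addr_ge0// mulr_ge0// addr_ge0.
  move=> c d xc cd d1; have c0 := le_trans x0 xc; have dp := le_trans c0 cd.
  have c1 := le_trans cd d1.
  have d01 : 0 <= d <= 1 by rewrite dp. have c01 : 0 <= c <= 1 by rewrite c0.
  pose dl := d - c; have dl0 : 0 <= dl by rewrite subr_ge0.
  have dl1 : dl <= 1 by rewrite /dl; lra.
  have hp := psi_prim c0 cd d1 T0 (hV d ^~ d01).
  rewrite -/dl -mulrA -/k in hp.
  have ht := hK d c d01 c01.
  have pE := psiE LP j c0 cd d1 T0; rewrite -/dl in pE.
  have eE : expR (- (d * T)) = expR (- (c * T)) * expR (- (dl * T)).
    by rewrite -expRD /dl; congr expR; ring.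
  have ec1 : expR (- (c * T)) <= 1 by rewrite expR_le1 oppr_le0 mulr_ge0.
  have ed1 : expR (- (dl * T)) <= 1 by rewrite expR_le1 oppr_le0 mulr_ge0.
  have ed2 : 1 - dl * T <= expR (- (dl * T)) by rewrite expR_ge1Dx.
  have ec0 := expR_ge0 (- (c * T)).
  (* [U] is bounded through [psi], itself at most the area of the column. *)
  have hU : `|dl * U j d T| <= dl * (T + k).
    have -> : dl * U j d T = psi j c d T - (psi j c d T - dl * U j d T) by ring.
    rewrite mulrDr; apply: le_trans (ler_normB _ _) _; apply: lerD.
      by rewrite ger0_norm ?psi_ge0// (psi_le LP).
    apply: le_trans hp _; rewrite ler_wpM2r// expr2 -[leRHS]mul1r ler_wpM2r//.
  have -> : g d - g c = - (expR (- (c * T)) * (psi j c d T - dl * U j d T))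
    + (expR (- (c * T)) * C j c T - expR (- (d * T)) * C j d T
        - (c - d) * - (expR (- (d * T)) * U j d T))
    - (expR (- (c * T)) * (1 - expR (- (dl * T)))) * (dl * U j d T).
    by rewrite /g pE eE /dl; ring.
  rewrite [leRHS](_ : _ = k * dl ^+ 2 + K * dl ^+ 2 + (T + k) * T * dl ^+ 2);
    last by rewrite /dl; ring.
  apply: le_trans (ler_normB _ _) _; apply: lerD.
    apply: le_trans (ler_normD _ _) _; apply: lerD.
      rewrite normrN normrM (ger0_norm ec0).
      apply: le_trans (ler_piMl (normr_ge0 _) ec1) _.
      by apply: le_trans hp _; rewrite mulrC.
    by apply: le_trans ht _; rewrite -[(c - d) ^+ 2]sqrrN opprB.
  rewrite normrM; have e1 : `|expR (- (c * T)) * (1 - expR (- (dl * T)))| <= dl * T.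
    rewrite normrM (ger0_norm ec0); apply: le_trans (ler_piMl (normr_ge0 _) ec1) _.
    by rewrite ger0_norm; lra.
  apply: le_trans (ler_pM (normr_ge0 _) (normr_ge0 _) e1 hU) _.
  by rewrite le_eqVlt; apply/orP; left; apply/eqP; rewrite -/dl; ring.
move: eq1; rewrite /g law_one// C_one subrr => /esym/eqP.
by rewrite subr_eq0 => /eqP /(mulfI (lt0r_neq0 (expR_gt0 _))).
Qed.

End RectangleLawExplicit.

(** * Records of box area at most s *)

Section HyperbolaRecords.
Context {R : realType} {d0 : measure_display} {Om : measurableType d0}.
Variables (P : probability Om R) (Pi : Om -> set (R * R)) (beta : Om -> R).
Variable F : R -> R.
Hypothesis LP : line_process P Pi beta F.
Variable s : R.
Hypothesis s0 : 0 < s.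
Implicit Types (b c d x : R) (j n : nat) (w : Om).
Local Notation y := (hyp s).
Local Notation hit := (hit Pi).
Local Notation void := (void Pi).
Local Notation pr := (pr P).

Definition left_records w := records_left_le (Pi w) (beta w) s.
Definition left_count j : set Om := [set w | left_records w #= `I_j].
Definition nwbox x : set (R * R) := bx `[0, x[ 0 (y x).

Lemma box_area_strip w (a : R * R) : Pi w a -> box_area a = (1 - a.1) * - a.2.
Proof. by move=> /(lp_strip LP)[_ h]; rewrite /box_area ler0_norm. Qed.

(** The atom lies on or above the hyperbola, whose depth increases with the abscissa. *)
Lemma left_of_hyp w (a : R * R) x : Pi w a -> box_area a <= s -> a.1 < x -> x < 1 ->
  - y x < a.2.
Proof.
move=> Xa; rewrite (box_area_strip Xa) => h ax x1; rewrite ltrNl ltNge; apply/negP => ya.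
have yp : 0 < y x by rewrite divr_gt0// subr_gt0.
have h1 : (1 - x) * y x < (1 - a.1) * y x by rewrite ltr_pM2r// ltrD2l ltrN2.
have h2 : (1 - a.1) * y x <= (1 - a.1) * - a.2.
  by rewrite ler_wpM2l// subr_ge0 ltW// (lt_trans ax).
by rewrite hypE// in h1; lra.
Qed.

Lemma right_of_hyp w (a : R * R) x : Pi w a -> x < 1 -> x <= a.1 -> - y x < a.2 ->
  box_area a <= s.
Proof.
move=> Xa x1 xa ya; have [/andP[_ a1] a2] := lp_strip LP Xa.
rewrite (box_area_strip Xa) -(hypE s x1); apply: ler_pM; rewrite ?subr_ge0 ?oppr_ge0//.
  by rewrite lerD2l lerN2.
by rewrite lerNl ltW.
Qed.

Lemma in_nwbox w (a : R * R) x : Pi w a -> a.1 < x -> - y x < a.2 -> nwbox x a.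
Proof.
by move=> /(lp_strip LP)[/andP[? ?] ?] ? ?; apply/bx_oP; rewrite oppr0.
Qed.

(** The meeting is on a horizontal step: an atom left of c, at depth between y c and y d, beats the
    deeper atoms to its right, so the counted records lie right of d and above depth y c. *)
Lemma left_records_row w c d : 0 <= c -> c <= d -> d < 1 ->
  void (nwbox c) w -> void (col c d (y c)) w -> void (bx `[c, d[ (y c) (y d)) w ->
  void (bx `[d, 1] (y c) (y d)) w -> hit (bx `[0, c[ (y c) (y d)) w ->
  left_records w = recs Pi beta d (y c) w.
Proof.
move=> c0 cd d1 /voidP vn /voidP vc /voidP vk /voidP vr /hitP[a1 X1 /bx_oP[h1 h2 h3 h4]].
have c1 := le_lt_trans cd d1.
apply/seteqP; split => a.
  move=> [[Xa nr] [ab aD]].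
  have ca : c <= a.1.
    rewrite leNgt; apply/negP => ac; apply: (vn a Xa); apply: (in_nwbox Xa ac).
    exact: left_of_hyp Xa aD ac c1.
  have [k1 k2] := lp_strip LP Xa; have /andP[_ k3] := k1.
  have da : d <= a.1.
    rewrite leNgt; apply/negP => ad; have ay := left_of_hyp Xa aD ad d1.
    have [ya|ya] := leP a.2 (- y c); first by apply: (vk a Xa); apply/bx_oP.
    by apply: (vc a Xa); apply/bx_oP; rewrite oppr0.
  have ya : - y c < a.2.
    rewrite ltNge; apply/negP => ya; have [a1a|aa1] := ltP a.2 a1.2.
      have nw1 : north_west a1 a by split; lra.
      apply: nr; exists a1; split => //; split => // e; move: nw1; rewrite e => -[].
      by rewrite ltxx.
    by apply: (vr a Xa); apply/bx_cP; split => //; lra.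
  split; last by split.
  split; first by split => //; exact: (in_rbox LP Xa).
  by move=> [b [[Xb _] nb]]; apply: nr; exists b.
move=> [[[Xa /bx_cP[k1 k2 k3 k4]] nr] [ab _]].
split; last by split => //; apply: (right_of_hyp Xa c1) => //; lra.
split => // -[b [Xb [ba nb]]]; have [n1 n2] := nb; apply: nr; exists b.
split => //; split => //; apply: (in_rbox LP Xb); last by lra.
have [k5 k6] := lp_strip LP Xb.
rewrite leNgt; apply/negP => bd; have [bc|cb] := ltP b.1 c.
  by apply: (vn b Xb); apply: (in_nwbox Xb) => //; lra.
by apply: (vc b Xb); apply/bx_oP; rewrite oppr0; split => //; lra.
Qed.

(** The meeting is on a vertical step: an atom of the column beats the deeper atoms right of d, and
    the void corner excludes those left of d that could count. *)
Lemma left_records_col w c d : 0 <= c -> c <= d -> d < 1 ->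
  void (nwbox c) w -> void (bx `[c, d[ (y c) (y d)) w -> hit (col c d (y c)) w ->
  left_records w = recs Pi beta c (y c) w.
Proof.
move=> c0 cd d1 /voidP vn /voidP vk /hitP[a1 X1 /bx_oP[h1 h2 h3 h4]].
have c1 := le_lt_trans cd d1.
apply/seteqP; split => a.
  move=> [[Xa nr] [ab aD]].
  have ca : c <= a.1.
    rewrite leNgt; apply/negP => ac; apply: (vn a Xa); apply: (in_nwbox Xa ac).
    exact: left_of_hyp Xa aD ac c1.
  have ya : - y c < a.2.
    rewrite ltNge; apply/negP => ya; have [ad|da] := ltP a.1 d.
      by apply: (vk a Xa); apply/bx_oP; split => //; exact: left_of_hyp Xa aD ad d1.
    have nw1 : north_west a1 a by split; lra.
    apply: nr; exists a1; split => //; split => // e; move: nw1; rewrite e => -[].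
    by rewrite ltxx.
  split; last by split.
  split; first by split => //; exact: (in_rbox LP Xa).
  by move=> [b [[Xb _] nb]]; apply: nr; exists b.
move=> [[[Xa /bx_cP[k1 k2 k3 k4]] nr] [ab _]].
split; last by split => //; exact: (right_of_hyp Xa c1).
split => // -[b [Xb [ba nb]]]; have [n1 n2] := nb; apply: nr; exists b.
split => //; split => //; apply: (in_rbox LP Xb); last by lra.
rewrite leNgt; apply/negP => bc.
by apply: (vn b Xb); apply: (in_nwbox Xb) => //; lra.
Qed.

Lemma measurable_box_area : measurable [set a : R * R | box_area a <= s].
Proof.
have mf : measurable_fun setT (fun a : R * R => (1 - a.1) * `|a.2|).
  apply: measurable_funM.
    by apply: measurable_funB => //; exact: measurable_fst.
  by apply: measurableT_comp => //; exact: measurable_snd.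
have := mf measurableT _ (measurable_itv `]-oo, s]); rewrite setTI.
by congr (measurable _); apply/seteqP; split => a /=; rewrite in_itv.
Qed.

Lemma measurable_left_count j : measurable (left_count j).
Proof.
have mstrip : measurable (strip : set (R * R)).
  rewrite (_ : strip = [set a | a.1 \in `[0, 1]] `&` [set a | a.2 \in `]-oo, 0]]).
    by apply: measurableI; [exact: measurable_fst_itv|exact: measurable_snd_itv].
  by apply/seteqP; split => a /=; rewrite !in_itv /=.
have := obs_rec_card LP mstrip (@subset_refl _ _) j measurable_box_area.
move=> /(obs_measurable LP); congr (measurable _).
apply/seteqP; split => w /=; rewrite /left_count /= (_ : left_records w =
  rec_set Pi beta strip [set a | box_area a <= s] w)//;
  by rewrite /left_records /records_left_le /rec_set setIidl//; exact: (lp_strip LP).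
Qed.

End HyperbolaRecords.

(** * The law along the hyperbola *)

Section HyperbolaLaw.
Context {R : realType} {d0 : measure_display} {Om : measurableType d0}.
Variables (P : probability Om R) (Pi : Om -> set (R * R)) (beta : Om -> R).
Variable F : R -> R.
Hypothesis LP : line_process P Pi beta F.
Variable s : R.
Hypothesis s0 : 0 < s.
Implicit Types (b c d x : R) (j n : nat).
Local Notation y := (hyp s).
Local Notation hit := (hit Pi).
Local Notation void := (void Pi).
Local Notation pr := (pr P).
Local Notation law := (law P Pi beta).
Local Notation nwbox := (nwbox s).
Local Notation left_count := (left_count Pi beta s).

(* The staircase of records meets the hyperbola to the right of [x] exactly when no
   atom lies north-west of the point of abscissa [x]. *)
Definition cross j x : R := pr (void (nwbox x) `&` left_count j).

Lemma cross_le j x : 0 <= x -> x < 1 -> cross j x <= ehyp s x.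
Proof.
move=> x0 x1; have y0 := hyp_ge0 s0 x1.
have an : admissible (nwbox x) by apply: admissible_bx_o => //; exact: ltW.
apply: (@le_trans _ _ (pr (void (nwbox x)))).
  apply: pr_le; last by move=> w [].
    apply: measurableI; first exact: (measurable_void LP).
    exact: (measurable_left_count LP).
  exact: (measurable_void LP).
by rewrite (pr_void_bx LP)// ?subr0// ltW.
Qed.

Lemma cross_zero j : cross j 0 = pr (left_count j).
Proof.
rewrite /cross (_ : void _ = setT) ?setTI//; apply/seteqP; split => // w _.
by apply/voidP => a _ /bx_oP[h1 h2 _ _]; lra.
Qed.

(** [nwbox d] exceeds [nwbox c] by the row, the column and the corner. The difference is the
    probability of hitting one of them while [nwbox c] is void, and which one is hit tells which
    rectangle carries the count. *)
Lemma cross_increment j b : b < 1 ->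
  exists2 K : R, 0 <= K & forall c d, 0 <= c -> c <= d -> d <= b ->
    `|cross j c - cross j d - hyp_step s law j c d| <= K * (d - c) ^+ 2.
Proof.
move=> b1; have [L L0 hL] := lip_hyp s b1.
exists (2 * (L + L * y b + L * L)) => [|c d c0 cd db].
  by rewrite mulr_ge0// !addr_ge0// mulr_ge0// hyp_ge0.
have d1 := le_lt_trans db b1; have c1 := le_lt_trans cd d1.
have dp := le_trans c0 cd; have d1' := ltW d1; have c1' := ltW c1.
have yc0 := hyp_ge0 s0 c1; have yd0 := hyp_ge0 s0 d1.
have ycd : y c <= y d by exact: le_hyp.
have ycb : y c <= y b by apply: le_hyp => //; exact: le_trans db.
pose dl := d - c; have dl0 : 0 <= dl by rewrite subr_ge0.
have dyle : y d - y c <= L * dl.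
  have := hL c d; rewrite c0 dp db (le_trans cd db) => /(_ isT isT).
  by rewrite !ger0_norm// subr_ge0.
have dy0 : 0 <= y d - y c by rewrite subr_ge0.
pose row := bx `[0, c[ (y c) (y d); pose cl := col c d (y c).
pose corner := bx `[c, d[ (y c) (y d); pose rowr := bx `[d, 1] (y c) (y d).
have an : admissible (nwbox c) by exact: admissible_bx_o.
have ad : admissible (nwbox d) by exact: admissible_bx_o.
have arow : admissible row by exact: admissible_bx_o.
have acl : admissible cl by exact: admissible_bx_o.
have aco : admissible corner by exact: admissible_bx_o.
have arr : admissible rowr by exact: admissible_bx_c.
have mH := measurable_hit LP; have mVd := measurable_void LP.
have mE := measurable_left_count LP s j.
pose A := void (nwbox c) `&` (hit (row `|` cl `|` corner) `&` left_count j).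
pose A1 := void (nwbox c) `&` (hit row `&` cnt Pi beta d (y c) j).
pose A2 := void (nwbox c) `&` (hit cl `&` cnt Pi beta c (y c) j).
(* The corner has both sides of order d - c, and each other term requires hits in two disjoint
   regions whose areas are of order d - c. *)
pose B := hit corner `|` hit row `&` hit cl `|` hit row `&` hit rowr.
have al : admissible (row `|` cl `|` corner) by do 2 apply: admissibleU => //.
have mA : measurable A.
  by apply: measurableI; [exact: mVd|apply: measurableI => //; exact: mH].
have mA1 : measurable A1.
  apply: measurableI; [exact: mVd|apply: measurableI; first exact: mH].
  exact: (measurable_cnt LP).
have mA2 : measurable A2.
  apply: measurableI; [exact: mVd|apply: measurableI; first exact: mH].
  exact: (measurable_cnt LP).
have mB1 : measurable (hit row `&` hit cl) by apply: measurableI; exact: mH.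
have mB2 : measurable (hit row `&` hit rowr) by apply: measurableI; exact: mH.
have mB12 : measurable (hit corner `|` hit row `&` hit cl).
  by apply: measurableU => //; exact: mH.
have mB : measurable B by exact: measurableU.
have void_d w : void (nwbox d) w <->
    void (nwbox c) w /\ void (row `|` cl `|` corner) w.
  split=> [/voidP v|[/voidP v1 /voidP v2]].
    split; apply/voidP => a Xa.
      move=> /bx_oP[k1 k2 k3 k4]; apply: (v a Xa); apply/bx_oP; split => //; lra.
    move=> h; apply: (v a Xa); have [/andP[l1 l2] l3] := lp_strip LP Xa.
    apply/bx_oP; rewrite oppr0.
    by case: h => [[/bx_oP[k1 k2 k3 k4]|/bx_oP[k1 k2 k3 k4]]|/bx_oP[k1 k2 k3 k4]];
      split => //; lra.
  apply/voidP => a Xa /bx_oP[k1 k2 k3 k4].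
  have [ac|ca] := ltP a.1 c; have [ay|ya] := leP a.2 (- y c).
  - by apply: (v2 a Xa); left; left; apply/bx_oP.
  - by apply: (v1 a Xa); apply/bx_oP.
  - by apply: (v2 a Xa); right; apply/bx_oP.
  - by apply: (v2 a Xa); left; right; apply/bx_oP.
have crossE : cross j c - cross j d = pr A.
  have mvc : measurable (void (nwbox c) `&` left_count j).
    by apply: measurableI => //; exact: mVd.
  rewrite /cross (pr_split P mvc (mVd _ ad)).
  rewrite [X in X + _ - _](_ : _ = cross j d).
    rewrite addrAC subrr add0r; congr (pr _); apply/seteqP; split => w.
      move=> [[v e] nd]; split => //; split => // v2; apply: nd; exact/void_d.
    by move=> [v [h e]]; split; [split|move=> /void_d[_ v2]; exact: h].
  rewrite /cross; congr (pr _); apply/seteqP; split => w; first by move=> [[_ e] v].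
  by move=> [v e]; split => //; split => //; case/void_d : v.
have pn : pr (void (nwbox c)) = ehyp s c by rewrite (pr_void_bx LP)// !subr0.
have pA1 : pr A1 = ehyp s c * ((1 - expR (- (c * (y d - y c)))) * law j d (y c)).
  have o : obs Pi beta (rbox d (y c)) (cnt Pi beta d (y c) j) by exact: (obs_cnt LP).
  have o2 : obs Pi beta (row `|` rbox d (y c)) (hit row `&` cnt Pi beta d (y c) j).
    by apply: obsI; [apply: obs_hit => // a; left|apply: obsS o => a; right].
  rewrite (obs_indep LP an _ o2); last first.
    by rewrite setIUr /nwbox /rbox bx_disj_x// bx_disj_t// setU0.
  rewrite (pr_hitI LP arow _ o); last by rewrite setIC; exact: bx_disj_t.
  by rewrite pn (pr_hit LP arow) (pr_void_bx LP)// subr0.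
have pA2 : pr A2 = ehyp s c * (law j c (y c) - expR (- ((d - c) * y c)) * law j d (y c)).
  have o : obs Pi beta (rbox c (y c)) (cnt Pi beta c (y c) j) by exact: (obs_cnt LP).
  have o2 : obs Pi beta (rbox c (y c)) (hit cl `&` cnt Pi beta c (y c) j).
    apply: obsI => //; apply: obs_hit => // a /bx_oP[? ? ? ?].
    by apply/bx_cP; split => //; lra.
  rewrite (obs_indep LP an _ o2); last exact: bx_disj_x.
  by rewrite pn -(psiE LP).
have -> : hyp_step s law j c d = pr A1 + pr A2 by rewrite pA1 pA2 /hyp_step; ring.
have hrow : pr (hit row) <= L * dl.
  have := pr_hit_le LP arow; rewrite area_bx_o//= subr0 => /le_trans; apply.
  by apply: le_trans (ler_piMl dy0 c1') dyle.
have prB : pr B <= (L + L * y b + L * L) * dl ^+ 2.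
  rewrite [leRHS](_ : _ = dl * (L * dl) + (L * dl) * (dl * y b) + (L * dl) * (L * dl));
    last by ring.
  apply: le_trans (pr_setU_le P mB12 mB2) _; apply: lerD.
  apply: le_trans (pr_setU_le P (mH _ aco) mB1) _; apply: lerD.
  - have := pr_hit_le LP aco; rewrite area_bx_o//= => /le_trans; apply.
    by rewrite ler_wpM2l.
  - have o : obs Pi beta cl (hit cl) by apply: obs_hit.
    rewrite (pr_hitI LP arow _ o); last by rewrite setIC; exact: bx_disj_t.
    apply: ler_pM; [exact: pr_ge0|exact: pr_ge0|exact: hrow|].
    have := pr_hit_le LP acl; rewrite area_bx_o//= subr0 => /le_trans; apply.
    by rewrite ler_wpM2l.
  - have o : obs Pi beta rowr (hit rowr) by apply: obs_hit.
    rewrite (pr_hitI LP arow _ o); last exact: bx_disj_x.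
    apply: ler_pM; [exact: pr_ge0|exact: pr_ge0|exact: hrow|].
    have := pr_hit_le LP arr; rewrite area_bx_c//= => /le_trans; apply.
    by apply: le_trans (ler_piMl dy0 _) dyle; rewrite lerBlDr lerDl.
rewrite crossE -mulrA; apply: le_trans (ler_wpM2l _ prB) => //.
apply: pr_approx => // w nB; last first.
  by move=> [_ [h1 _]] [_ [h2 _]]; apply: nB; left; right.
have vk : void corner w.
  by apply: contrapT => h; apply: nB; left; left.
have nB1 : hit row w -> void cl w.
  by move=> h; apply: contrapT => h'; apply: nB; left; right.
have nB2 : hit row w -> void rowr w.
  by move=> h; apply: contrapT => h'; apply: nB; right.
have keyr : void (nwbox c) w -> hit row w -> left_count j w <-> cnt Pi beta d (y c) j w.
  move=> v h; rewrite /left_count /cnt /=.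
  by rewrite (left_records_row LP s0 c0 cd d1 v (nB1 h) vk (nB2 h) h).
have keyc : void (nwbox c) w -> hit cl w -> left_count j w <-> cnt Pi beta c (y c) j w.
  move=> v h; rewrite /left_count /cnt /=.
  by rewrite (left_records_col LP s0 c0 cd d1 v vk h).
have hitS (Q Q' : set (R * R)) : Q `<=` Q' -> hit Q w -> hit Q' w.
  by move=> QQ' /hitP[a Xa Qa]; apply/hitP; exists a => //; exact: QQ'.
split.
  move=> [v [hl e]]; have [hr|nr] := pselect (hit row w).
    by left; split => //; split => //; apply/keyr.
  right; split => //; have hc : hit cl w.
    move: hl => /hitP[a Xa [[ra|ca]|ka]].
    - by exfalso; apply: nr; apply/hitP; exists a.
    - by apply/hitP; exists a.
    - by exfalso; move/voidP : vk => /(_ a Xa).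
  by split => //; apply/keyc.
move=> [[v [h e]]|[v [h e]]]; split => //; split.
- by apply: hitS h => a; left; left.
- exact/keyr.
- by apply: hitS h => a; left; right.
- exact/keyc.
Qed.

Variables C : nat -> R -> R -> R.
Hypothesis lawE : forall j x T, 0 <= x <= 1 -> 0 <= T -> law j x T = C j x T.

(** [cross j] and [hyp_fun] differ by a constant on [0, 1[; both are O(1 - x) at x = 1, so the
    constant is 0. At x = 0 the void condition in [cross] is empty. *)
Theorem left_count_law j k l m :
  (forall b, b < 1 -> exists2 K : R, 0 <= K & forall c d, 0 <= c -> c <= d -> d <= b ->
    `|hyp_fun s k l m c - hyp_fun s k l m d - hyp_step s C j c d| <= K * (d - c) ^+ 2) ->
  pr (left_count j) = hyp_fun s k l m 0.
Proof.
move=> hPhi; pose f x := cross j x - hyp_fun s k l m x.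
have fE b : 0 <= b -> b < 1 -> f b = f 0.
  move=> bp b1; have [K K0 hK] := hPhi b b1; have [N N0 hN] := cross_increment j b1.
  apply: (@increment_eq _ f 0 b (N + K)) => //; first exact: addr_ge0.
  move=> c d c0 cd db; have h1 := hN c d c0 cd db; have h2 := hK c d c0 cd db.
  have d1 := le_lt_trans db b1; have c1 := le_lt_trans cd d1.
  have eqs : hyp_step s law j c d = hyp_step s C j c d.
    have y0 := hyp_ge0 s0 c1.
    by rewrite /hyp_step !lawE// ?c0 ?(ltW c1)// (le_trans c0 cd) ltW.
  rewrite eqs in h1.
  rewrite mulrDl; apply: le_trans (lerD h1 h2); apply: le_trans (ler_normB _ _).
  by rewrite -[leLHS]normrN le_eqVlt; apply/orP; left; apply/eqP; congr (`|_|);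
    rewrite /f; ring.
pose M := (`|k| + `|l|) * (2 / s) + `|m| + 2 / s.
have M0 : 0 <= M by rewrite !addr_ge0// ?mulr_ge0 ?addr_ge0 ?invr_ge0// ltW.
have bound b : 2^-1 <= b -> b < 1 -> `|f 0| <= M * (1 - b).
  move=> b2 b1; have bp : 0 <= b by lra.
  rewrite -(fE b bp b1) /f; apply: le_trans (ler_normB _ _) _.
  rewrite /M mulrDl addrC; apply: lerD; first exact: hyp_fun_end.
  rewrite ger0_norm ?pr_ge0//; apply: le_trans (cross_le j bp b1) _.
  exact: ehyp_end.
have f0 : f 0 = 0.
  apply/eqP; rewrite -normr_le0; apply/ler_addgt0Pr => e e0; rewrite add0r.
  (* This makes M t at most e while 1 - t stays in [1/2, 1[. *)
  pose t := Num.min 2^-1 (e / (M + 1)).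
  have M1 : 0 < M + 1 by rewrite ltr_wpDl.
  have t0 : 0 < t by rewrite lt_min divr_gt0// andbT invr_gt0.
  have t2 : t <= 2^-1 by rewrite ge_min lexx.
  have te : t <= e / (M + 1) by rewrite ge_min lexx orbT.
  have := bound (1 - t); have -> : 1 - (1 - t) = t by ring.
  move=> /(_ _ _)/le_trans; apply; [lra|lra|].
  rewrite ler_pdivlMr// in te; apply: le_trans te.
  by rewrite mulrC ler_wpM2l ?(ltW t0)// lerDl.
by rewrite -cross_zero; apply/eqP; rewrite -subr_eq0; apply/eqP.
Qed.

End HyperbolaLaw.

(** * The two lines and the conclusion *)

Section Instances.
Context {R : realType} {d0 : measure_display} {Om : measurableType d0}.
Variables (P : probability Om R) (Pi : Om -> set (R * R)) (W : Om -> R).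
Hypothesis H : poisson_strip_uniform P Pi W.

(** The line x = 2 is beyond the strip: every record is on its left, and it never falls left of an x
    in [0, 1], whence F = 0. *)
Lemma line_process_all : line_process P Pi (cst 2) (cst 0).
Proof.
move: H => [H1 [H2 [H3 [H4 [_ _]]]]]; split => //.
- move=> A B mA aB; rewrite preimage_cst; case: ifP => _.
    by rewrite setTI probability_setT mul1e.
  by rewrite set0I measure0 mul0e.
- move=> x /andP[_ x1]; rewrite preimage_cst; case: ifPn; rewrite ?measure0//.
  by rewrite inE /= in_itv /= => x2; exfalso; lra.
- by move=> c d _ cd _; rewrite /= subrr subr_ge0.
Qed.

Lemma line_process_left : line_process P Pi W id.
Proof.
move: H => [H1 [H2 [H3 [H4 [_ [H5 [H6 H7]]]]]]]; split => //.
- move=> A B mA aB.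
  have := H7 1%N (fun=> B) (fun=> 0%N) A (fun=> aB) mA.
  by rewrite bigcap_const; last by exists ord0.
- move=> x /andP[x0 x1]; rewrite H6; last exact: measurable_itv.
  rewrite (_ : _ `&` _ = `[0, x[%classic).
    rewrite lebesgue_measure_itv /= lte_fin; case: ifPn => [_|].
      by rewrite -EFinB subr0.
    by rewrite -leNgt => x00; congr EFin; apply/eqP; rewrite eq_le x0 x00.
  apply/seteqP; split => z /=; rewrite !in_itv /=.
    by move=> [zx /andP[z0 _]]; rewrite z0 zx.
  by move=> /andP[-> zx]; rewrite zx /=; split => //; rewrite (le_trans _ x1)// ltW.
Qed.

Variable s : R.
Hypothesis s0 : 0 < s.

Lemma p_infE j : p_inf P Pi j s = (hint s 1 * pj j s + (1 - hint s 1) * qpred s j)%:E.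
Proof.
have LP := line_process_all.
have lawE := rect_law LP (@tangent_all_prim R) (@all_prim0 R) (@tangent_all_law R) (@all_law1 R).
have := left_count_law LP s0 lawE (@all_phi_step _ _ s0 j).
rewrite -/(all_phi s j) all_phi0 => <-.
rewrite -prE; last exact: (measurable_left_count LP).
rewrite /p_inf; congr (P _); apply/seteqP; split => w; rewrite /left_count /=;
  rewrite (_ : left_records _ _ _ _ = records_le (Pi w) s)//;
  apply/seteqP; split => a; rewrite /left_records /records_left_le /records_le /=.
- by move=> [? []].
- move=> [ra ?]; split => //; split => //.
  by case: ra => /(lp_strip LP)[/andP[_ ?] _] _; lra.
- by move=> [? []].
- move=> [ra ?]; split => //; split => //.
  by case: ra => /(lp_strip LP)[/andP[_ ?] _] _; lra.
Qed.

Lemma q_infE j : q_inf P Pi W j s = (hint s 1 * pj j s + (1 - hint s 1) * qser j s)%:E.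
Proof.
have LP := line_process_left.
have lawE := rect_law LP (@tangent_left_prim R) (@left_prim0 R) (@tangent_left_law R) (@left_law1 R).
have := left_count_law LP s0 lawE (@left_phi_step _ _ s0 j).
rewrite -/(left_phi s j) left_phi0 => <-.
by rewrite -prE//; exact: (measurable_left_count LP).
Qed.

End Instances.

Theorem theorem5 (R : realType) (d : measure_display) (Om : measurableType d)
  (P : probability Om R) (Pi : Om -> set (R * R)) (W : Om -> R) :
  poisson_strip_uniform P Pi W ->
  forall s : R, 0 < s ->
    (forall j : nat, (1 <= j)%N ->
       (q_inf P Pi W j s = p_inf P Pi j s <-> qj j.-1 s = qj j s)) /\
    (forall j : nat,
       (q_inf P Pi W j s = p_inf P Pi j.+1 s <-> pj j s = pj j.+1 s)).
Proof.
move=> H s s0; have /andP[h0 h1] := hint1_bounds s0.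
have nh : 1 - hint s 1 != 0 by rewrite subr_eq0 gt_eqF.
(* In (i) the terms H p_j(s) cancel and 1 - H is divided out; in (ii) the terms (1 - H) q_j(s)
   cancel and H is divided out. *)
split=> [[|j]//= _|j]; rewrite (q_infE H s0) (p_infE H s0) /= ?qjE//; split.
- by move=> [/addrI/(mulfI nh) ->].
- by move=> ->.
- by move=> [/addIr/(mulfI (lt0r_neq0 h0))].
- by move=> ->.
Qed.
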